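(* Let $n$ be an integer with $|n|>2$. The polynomial $\hat p_n(y)$ is irreducible over $\mathbb{Q}$ and is the minimal polynomial for the trace field of $M_n$. The degree of the trace field over $\mathbb{Q}$ is $|n|-e$, where $e=0$ if $n$ is even and $e=1$ if $n$ is odd.
   Context: $T$ is the once-punctured torus, $b,c$ are simple closed curves on $T$ meeting transversally once, $\tau_a$ is the right-handed Dehn twist along $a$, and $M_n$ is the once-punctured torus bundle with monodromy $\tau_c\tau_b^{n+2}$. Its fundamental group is $\Gamma_n=\langle \alpha,\beta : \beta^{-n}=\alpha^{-1}\beta\alpha^2\beta\alpha^{-1}\rangle$. For $|n|>2$, $M_n$ is a one-cusped finite volume hyperbolic manifold. The trace field of $M_n$ is the field generated over $\mathbb{Q}$ by the traces $\mathrm{tr}\,\rho_0(\gamma)$, $\gamma\in\Gamma_n$, where $\rho_0:\Gamma_n\to\mathrm{SL}_2(\mathbb{C})$ is a discrete faithful representation. That $\hat p_n$ is the minimal polynomial for the trace field means that the trace field is $\mathbb{Q}(y_0)$, where $y_0=\mathrm{tr}\,\rho_0(\beta)$ has minimal polynomial $\hat p_n$ over $\mathbb{Q}$. Polynomials: $f_0(y)=0$, $f_1(y)=1$, $f_{k-1}(y)+f_{k+1}(y)=yf_k(y)$ for all $k\in\mathbb{Z}$, and $p_n(y)=f_{n+1}(y)-f_{n-1}(y)-y^2+6$. If $n$ is even, $\hat p_n=p_n$. If $n$ is odd, $\hat p_n$ is the polynomial with $p_n(y)=(y+2)\hat p_n(y)$. *)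

(* Defs.v *)
From HB Require Import structures.
From mathcomp Require Import all_boot all_order all_algebra.
From mathcomp Require Import all_classical all_reals all_analysis.
From mathcomp Require Import complex ring.

Set Implicit Arguments.
Unset Strict Implicit.
Unset Printing Implicit Defensive.

Import Order.TTheory GRing.Theory Num.Theory.
Import numFieldNormedType.Exports.

Local Open Scope ring_scope.
Local Open Scope classical_set_scope.
Local Open Scope quotient_scope.

(* The letter (x, false) stands for the generator x, and (x, true) for its
   inverse. *)
Definition letter (X : Type) : Type := (X * bool)%type.
Definition word (X : Type) : Type := seq (letter X).

Definition inv_letter (X : Type) (l : letter X) : letter X := (l.1, ~~ l.2).
Definition inv_word (X : Type) (w : word X) : word X :=
  rev (map (@inv_letter X) w).

Definition wexp (X : Type) (x : X) (k : int) : word X :=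
  match k with
  | Posz m => nseq m (x, false)
  | Negz m => nseq m.+1 (x, true)
  end.

(* A pair (r1, r2) of words in rels is the relation r1 = r2. *)
Inductive word_eqv (X : Type) (rels : set (word X * word X)) :
    word X -> word X -> Prop :=
| word_eqv_refl w : word_eqv rels w w
| word_eqv_sym v w : word_eqv rels v w -> word_eqv rels w v
| word_eqv_trans u v w :
    word_eqv rels u v -> word_eqv rels v w -> word_eqv rels u w
| word_eqv_free u v l : word_eqv rels (u ++ [:: l; inv_letter l] ++ v) (u ++ v)
| word_eqv_rel u v r1 r2 :
    rels (r1, r2) -> word_eqv rels (u ++ r1 ++ v) (u ++ r2 ++ v).

Section PresentedGroup.
Variables (X : choiceType) (rels : set (word X * word X)).
Implicit Types u v w : word X.

Definition word_eqvb : rel (word X) := fun v w => `[< word_eqv rels v w >].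

Lemma word_eqvb_refl : reflexive word_eqvb.
Proof. by move=> w; apply/asboolP; exact: word_eqv_refl. Qed.

Lemma word_eqvb_sym : symmetric word_eqvb.
Proof. by move=> v w; apply/asboolP/asboolP; exact: word_eqv_sym. Qed.

Lemma word_eqvb_trans : transitive word_eqvb.
Proof.
move=> v u w /asboolP uv /asboolP vw; apply/asboolP; exact: word_eqv_trans vw.
Qed.

Canonical word_eqv_equiv :=
  EquivRel word_eqvb word_eqvb_refl word_eqvb_sym word_eqvb_trans.

Definition presented : Type := {eq_quot word_eqvb}.

HB.instance Definition _ := Choice.on presented.
HB.instance Definition _ := EqQuotient.on presented.

Lemma word_eqv_cat u u' v v' : word_eqv rels u u' -> word_eqv rels v v' ->
  word_eqv rels (u ++ v) (u' ++ v').
Proof.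
move=> uu vv; apply: (@word_eqv_trans _ _ _ (u' ++ v)).
  elim: uu v {v' vv} => [w|{}u w _ IH|w1 w2 w3 _ IH1 _ IH2|w1 w2 l|w1 w2 r1 r2 r] v.
  - exact: word_eqv_refl.
  - exact: word_eqv_sym.
  - exact: word_eqv_trans (IH2 _).
  - rewrite -!catA; exact: word_eqv_free.
  - rewrite -!catA; exact: word_eqv_rel.
elim: vv u' {u uu} => [w|{}u w _ IH|w1 w2 w3 _ IH1 _ IH2|w1 w2 l|w1 w2 r1 r2 r] v0.
- exact: word_eqv_refl.
- exact: word_eqv_sym.
- exact: word_eqv_trans (IH2 _).
- rewrite !(catA v0); exact: word_eqv_free.
- rewrite !(catA v0); exact: word_eqv_rel.
Qed.

Lemma inv_letterK : involutive (@inv_letter X).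
Proof. by case=> x b; rewrite /inv_letter /= negbK. Qed.

Lemma inv_wordK : involutive (@inv_word X).
Proof.
by move=> w; rewrite /inv_word map_rev revK mapK //; exact: inv_letterK.
Qed.

Lemma word_eqv_mulV w : word_eqv rels (w ++ inv_word w) [::].
Proof.
elim: w => [|l w IH]; first exact: word_eqv_refl.
apply: (@word_eqv_trans _ _ _ [:: l; inv_letter l]).
  rewrite /inv_word map_cons rev_cons -cats1 -(cat1s l) -(cat1s l [:: _]).
  rewrite -catA; apply: word_eqv_cat; first exact: word_eqv_refl.
  rewrite catA -[X in word_eqv _ _ X]cat0s.
  by apply: word_eqv_cat => //; exact: word_eqv_refl.
by have := word_eqv_free rels [::] [::] l.
Qed.

Lemma word_eqv_Vmul w : word_eqv rels (inv_word w ++ w) [::].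
Proof. by have := word_eqv_mulV (inv_word w); rewrite inv_wordK. Qed.

Lemma word_eqv_inv v w : word_eqv rels v w ->
  word_eqv rels (inv_word v) (inv_word w).
Proof.
move=> vw.
apply: (@word_eqv_trans _ _ _ (inv_word v ++ w ++ inv_word w)).
  rewrite -[X in word_eqv _ X _]cats0.
  apply: word_eqv_cat; first exact: word_eqv_refl.
  by apply: word_eqv_sym; exact: word_eqv_mulV.
rewrite catA -[X in word_eqv _ _ X]cat0s.
apply: word_eqv_cat; last exact: word_eqv_refl.
apply: word_eqv_trans (word_eqv_Vmul v).
apply: word_eqv_cat; first exact: word_eqv_refl.
exact: word_eqv_sym.
Qed.

Definition presented_class w : presented := \pi_presented w.

Lemma presented_classP v w :
  presented_class v = presented_class w <-> word_eqv rels v w.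
Proof.
by split=> [/eqP|vw]; [rewrite piE => /asboolP|apply/eqP; rewrite piE; apply/asboolP].
Qed.

Lemma presented_reprK (g : presented) : presented_class (repr g) = g.
Proof. exact: reprK. Qed.

Lemma repr_classP w : word_eqv rels (repr (presented_class w)) w.
Proof. by apply/presented_classP; rewrite presented_reprK. Qed.

Definition presented_one : presented := presented_class [::].
Definition presented_mul (g h : presented) : presented :=
  presented_class (repr g ++ repr h).
Definition presented_inv (g : presented) : presented :=
  presented_class (inv_word (repr g)).

Lemma presented_mul_class v w :
  presented_mul (presented_class v) (presented_class w) =
  presented_class (v ++ w).
Proof. by apply/presented_classP/word_eqv_cat; exact: repr_classP. Qed.

Lemma presented_inv_class w :
  presented_inv (presented_class w) = presented_class (inv_word w).
Proof. by apply/presented_classP/word_eqv_inv/repr_classP. Qed.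

Lemma presented_mulA : associative presented_mul.
Proof.
move=> f g h; rewrite -(presented_reprK f) -(presented_reprK g).
by rewrite -(presented_reprK h) !presented_mul_class catA.
Qed.

Lemma presented_mul1g : left_id presented_one presented_mul.
Proof. by move=> g; rewrite -(presented_reprK g) presented_mul_class. Qed.

Lemma presented_mulg1 : right_id presented_one presented_mul.
Proof. by move=> g; rewrite -(presented_reprK g) presented_mul_class cats0. Qed.

Lemma presented_mulVg : left_inverse presented_one presented_inv presented_mul.
Proof.
move=> g; rewrite -(presented_reprK g) presented_inv_class presented_mul_class.
by apply/presented_classP/word_eqv_Vmul.
Qed.

Lemma presented_mulgV : right_inverse presented_one presented_inv presented_mul.
Proof.
move=> g; rewrite -(presented_reprK g) presented_inv_class presented_mul_class.
by apply/presented_classP/word_eqv_mulV.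
Qed.

HB.instance Definition _ := isGroup.Build presented presented_mulA
  presented_mul1g presented_mulg1 presented_mulVg presented_mulgV.

End PresentedGroup.

Definition Gamma_rel (n : int) : word bool * word bool :=
  let a := wexp false in let b := wexp true in
  (b (- n), a (-1) ++ b 1 ++ a 2 ++ b 1 ++ a (-1)).

(* The fundamental group of M_n; the two generators are indexed by bool. *)
Definition Gamma (n : int) : groupType := presented [set Gamma_rel n].
Definition Gamma_alpha (n : int) : Gamma n :=
  presented_class [set Gamma_rel n] (wexp false 1).
Definition Gamma_beta (n : int) : Gamma n :=
  presented_class [set Gamma_rel n] (wexp true 1).

Section SL2.
Variable K : comUnitRingType.

Record SL2 : Type := MkSL2 {
  SL2_val :> 'M[K]_2;
  SL2_valP : \det SL2_val == 1
}.

HB.instance Definition _ := [isSub for SL2_val].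
HB.instance Definition _ := [Choice of SL2 by <:].

Lemma SL2_one_subproof : \det (1%:M : 'M[K]_2) == 1.
Proof. by rewrite det1. Qed.

Lemma SL2_mul_subproof (A B : SL2) : \det (A *m B) == 1.
Proof. by rewrite det_mulmx (eqP (SL2_valP A)) (eqP (SL2_valP B)) mulr1. Qed.

Lemma SL2_inv_subproof (A : SL2) : \det (invmx A) == 1.
Proof. by rewrite det_inv (eqP (SL2_valP A)) invr1. Qed.

Definition SL2_one : SL2 := MkSL2 SL2_one_subproof.
Definition SL2_mul (A B : SL2) : SL2 := MkSL2 (SL2_mul_subproof A B).
Definition SL2_inv (A : SL2) : SL2 := MkSL2 (SL2_inv_subproof A).

Lemma SL2_unitmx (A : SL2) : (A : 'M[K]_2) \in unitmx.
Proof. by rewrite unitmxE (eqP (SL2_valP A)) unitr1. Qed.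

Lemma SL2_mulA : associative SL2_mul.
Proof. by move=> A B C; apply: val_inj; exact: mulmxA. Qed.

Lemma SL2_mul1g : left_id SL2_one SL2_mul.
Proof. by move=> A; apply: val_inj; exact: mul1mx. Qed.

Lemma SL2_mulg1 : right_id SL2_one SL2_mul.
Proof. by move=> A; apply: val_inj; exact: mulmx1. Qed.

Lemma SL2_mulVg : left_inverse SL2_one SL2_inv SL2_mul.
Proof. by move=> A; apply: val_inj; exact: mulVmx (SL2_unitmx A). Qed.

Lemma SL2_mulgV : right_inverse SL2_one SL2_inv SL2_mul.
Proof. by move=> A; apply: val_inj; exact: mulmxV (SL2_unitmx A). Qed.

HB.instance Definition _ := isGroup.Build SL2
  SL2_mulA SL2_mul1g SL2_mulg1 SL2_mulVg SL2_mulgV.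

End SL2.

(* The image of rho is a discrete subset of SL_2(K), whose topology is induced
   from that of the space of matrices. *)
Definition discrete_rep (K : numFieldType) (G : groupType)
    (rho : G -> SL2 K) : Prop :=
  let A := range (fun g => rho g : 'M[K]_2) in A `<=` isolated A.

Definition faithful_rep (K : comUnitRingType) (G : groupType)
    (rho : G -> SL2 K) : Prop := injective rho.

(* The subfield of F generated by S. *)
Definition gen_subfield (F : fieldType) (S : set F) : set F :=
  [set x | forall k : {pred F}, GRing.divring_closed k ->
     (forall s, S s -> s \in k) -> x \in k].

Definition trace_field (F : fieldType) (G : groupType)
    (rho : G -> SL2 F) : set F :=
  gen_subfield (range (fun g => \tr (rho g : 'M[F]_2))).

Definition is_min_poly (F : fieldType) (x : F) (p : {poly rat}) : Prop :=
  p \is monic /\ forall q : {poly rat}, root (map_poly ratr q) x = (p %| q)%R.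

(* k, a Q-linear subspace of F, has dimension d over Q. *)
Definition has_degree (F : fieldType) (k : set F) (d : nat) : Prop :=
  exists b : 'I_d -> F, (forall i, k (b i)) /\
    forall x, k x -> exists! c : 'rV[rat]_d, x = \sum_(i < d) ratr (c 0 i) * b i.

Fixpoint fib_pair (m : nat) : {poly rat} * {poly rat} :=
  if m is m'.+1 then
    let: (u, v) := fib_pair m' in (v, 'X * v - u)
  else (0, 1).

(* The recursion f_(k-1) + f_(k+1) = y f_k, run backwards from f_0 = 0 and
   f_1 = 1, gives f_(-k) = - f_k; see fpoly_rec. *)
Definition fpoly (k : int) : {poly rat} :=
  match k with
  | Posz m => (fib_pair m).1
  | Negz m => - (fib_pair m.+1).1
  end.

Lemma fpoly0 : fpoly 0 = 0.
Proof. by []. Qed.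

Lemma fpoly1 : fpoly 1 = 1.
Proof. by []. Qed.

Lemma fib_pairSS m : (fib_pair m.+2).1 = 'X * (fib_pair m.+1).1 - (fib_pair m).1.
Proof. by rewrite /=; case: (fib_pair m). Qed.

Lemma fpoly_rec (k : int) : fpoly (k - 1) + fpoly (k + 1) = 'X * fpoly k.
Proof.
case: k => [[|m]|m].
- by rewrite (_ : 0%Z - 1 = Negz 0) // add0r fpoly0 fpoly1 /= mulr0 addNr.
- have -> : Posz m.+1 - 1 = m by rewrite -addn1 PoszD addrK.
  have -> : Posz m.+1 + 1 = m.+2 by rewrite -PoszD addn1.
  by rewrite /fpoly fib_pairSS addrC subrK.
- have -> : Negz m - 1 = Negz m.+1 by rewrite !NegzE -opprD -PoszD addn1.
  have -> : fpoly (Negz m + 1) = - (fib_pair m).1.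
    case: m => [|m]; first by rewrite NegzE addNr fpoly0 oppr0.
    by rewrite NegzE -addn1 PoszD opprD subrK; case: m.
  by rewrite /fpoly fib_pairSS opprB mulrN addrAC subrr add0r.
Qed.

Definition ppoly (n : int) : {poly rat} :=
  fpoly (n + 1) - fpoly (n - 1) - 'X^2 + 6%:R%:P.

(* For odd n the division is exact; see phatP. *)
Definition phat (n : int) : {poly rat} :=
  if odd `|n|%N then ppoly n %/ ('X + 2%:R%:P) else ppoly n.

Lemma fib_pair_horner m :
  (fib_pair m).1.[- 2] = (-1) ^+ m.+1 * m%:R /\
  (fib_pair m.+1).1.[- 2] = (-1) ^+ m * m.+1%:R.
Proof.
elim: m => [|m [IH1 IH2]]; first by rewrite /= !hornerE.
split; first by rewrite IH2 !exprS mulN1r mulN1r opprK.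
rewrite fib_pairSS !hornerE IH1 IH2 !exprS -(addn2 m) -(addn1 m) !natrD; ring.
Qed.

Lemma ppoly_odd_root (n : int) : odd `|n|%N -> root (ppoly n) (- 2).
Proof.
case: n => [] [|m] // odd_n; rewrite /root /ppoly; apply/eqP.
- have -> : Posz m.+1 - 1 = m by rewrite -addn1 PoszD addrK.
  have -> : Posz m.+1 + 1 = m.+2 by rewrite -PoszD addn1.
  have [e _] := fib_pair_horner m; have [e2 _] := fib_pair_horner m.+2.
  rewrite !hornerE /fpoly e e2 -(signr_odd _ m.+1) -(signr_odd _ m.+3).
  move: odd_n; rewrite /= negbK => /negbTE ->; rewrite -(addn2 m) natrD; ring.
- by rewrite !hornerE.
- have -> : Negz m.+1 - 1 = Negz m.+2 by rewrite !NegzE -opprD -PoszD addn1.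
  have -> : Negz m.+1 + 1 = Negz m.
    by rewrite NegzE -addn1 PoszD opprD subrK NegzE.
  have [e _] := fib_pair_horner m.+1; have [e2 _] := fib_pair_horner m.+3.
  rewrite !hornerE /fpoly e e2 -(signr_odd _ m.+2) -(signr_odd _ m.+4).
  move: odd_n; rewrite /= !negbK => ->.
  rewrite -(addn3 m) -(addn1 m) !natrD; ring.
Qed.

Lemma phatP (n : int) : odd `|n|%N -> ppoly n = ('X + 2%:R%:P) * phat n.
Proof.
move=> odd_n; rewrite /phat odd_n mulrC divpK //.
by have := ppoly_odd_root odd_n; rewrite -dvdp_XsubCl polyCN opprK.
Qed.

(* Main.v *)
From HB Require Import structures.
Require Import Defs.
From mathcomp Require Import all_boot all_order all_algebra.
From mathcomp Require Import all_classical all_reals all_analysis.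
From mathcomp Require Import complex.
From mathcomp Require Import ring lra zify.

Set Implicit Arguments.
Unset Strict Implicit.
Unset Printing Implicit Defensive.

Import Order.TTheory GRing.Theory Num.Theory.
Import numFieldNormedType.Exports.
Local Open Scope ring_scope.

(* Irreducibility.  Put y = t^2 + t^-2.  Since p_n(y) = s^n + s^-n - s^2 - s^-2 + 4
   for y = s + s^-1, the polynomial p_n becomes, up to a power of t, the product
   of Q = t^(2n) - t^(n+2) + t^(n-2) + 1 and its reversal Q'.  If Q = A B over Z
   then F = A' B satisfies F F' = Q Q' (Ljunggren's trick): the squares of the
   coefficients of F add up to 4, which forces F to be +-Q or +-Q', so that A or B
   is self-reciprocal up to sign and divides gcd (Q, Q'), which is 1 for n even
   and t^2 + 1 for n odd.  Hence Q, without its factor t^2 + 1 when n is odd, is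
   irreducible and coprime to its reversal, and a factorisation of phat_n would
   split that product in a self-reciprocal way, which is impossible.

   Trace field.  Let a, b be the images of alpha, beta and x, y, z the traces of
   a, b, ab.  As a and b do not commute, 1, a, b are linearly independent and the
   relation of Gamma_n says x^2 = 1 - f_(n-1), x z = y - f_n,
   f_n z = (f_(n+1) - 1) x.  The element beta alpha commutes with a conjugate of
   the boundary of the fibre; an action of Gamma_n on triples through a
   Heisenberg group extended by Z shows that the two generate a Z^2.  A
   discrete faithful image of Z^2 in SL_2(C) is parabolic up to sign, so
   z^2 = 4.  Eliminating x leaves phat_n(y) = 0, because the spurious factors
   would make beta a torsion element.  Finally x = (y - f_n) / z lies in Q(y) and
   all traces are polynomials in x, y, z. *)

(** * Quadrinomials with the autocorrelation of Q *)

(** A nonzero polynomial has finitely many roots, while a field of characteristic 0 has infinitely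
    many nonzero elements. Identities between reversals can thus be checked pointwise, at x and
    1/x. *)
Lemma poly_eq_horner_neq0 (F : numFieldType) (p q : {poly F}) :
  (forall x, x != 0 -> p.[x] = q.[x]) -> p = q.
Proof.
move=> pq; apply/eqP; rewrite -subr_eq0; set r := p - q; apply/negPn/negP => r0.
pose s := [seq i.+1%:R : F | i <- iota 0 (size r)].
have us : uniq s.
  by rewrite map_inj_uniq ?iota_uniq // => i j /eqP; rewrite eqr_nat => /eqP[].
have rs : all (root r) s.
  apply/allP => _ /mapP[i _ ->].
  by rewrite /root /r hornerD hornerN pq ?subrr ?pnatr_eq0.
by have := max_poly_roots r0 rs us; rewrite size_map size_iota ltnn.
Qed.

(** This is t^d p(1/t). The degree d is a parameter, so that reversal is multiplicative whenever the
    degree bounds add up. *)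
Definition revp (R : nzRingType) (d : nat) (p : {poly R}) : {poly R} :=
  \poly_(i < d.+1) p`_(d - i).

Lemma horner_revp (F : fieldType) (d : nat) (p : {poly F}) (x : F) :
  (size p <= d.+1)%N -> x != 0 -> (revp d p).[x] = x ^+ d * p.[x^-1].
Proof.
move=> sp x0; rewrite horner_poly (horner_coef_wide _ sp) mulr_sumr.
rewrite (reindex_inj rev_ord_inj) /=; apply: eq_bigr => i _.
rewrite subSS subKn -1?ltnS // exprVn mulrCA; congr (_ * _).
by rewrite exprB ?unitfE // -ltnS.
Qed.

Lemma size_revp (R : nzRingType) (d : nat) (p : {poly R}) :
  (size (revp d p) <= d.+1)%N.
Proof. exact: size_poly. Qed.

Lemma map_revp (R S : nzRingType) (f : {rmorphism R -> S}) d p :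
  map_poly f (revp d p) = revp d (map_poly f p).
Proof.
apply/polyP => i; rewrite coef_map [in LHS]coef_poly [in RHS]coef_poly coef_map.
by case: ifP => _ //; exact: rmorph0.
Qed.

Definition quadri (n : nat) : {poly rat} := 'X^(n.*2) - 'X^(n + 2) + 'X^(n - 2) + 1.
Definition quadri_rev (n : nat) : {poly rat} := 'X^(n.*2) + 'X^(n + 2) - 'X^(n - 2) + 1.

Lemma horner_quadri_rev n x : (2 <= n)%N -> x != 0 ->
  (quadri_rev n).[x] = x ^+ n.*2 * (quadri n).[x^-1].
Proof.
move=> n_ge2 x0; have -> : n = (n - 2 + 2)%N by rewrite subnK.
rewrite /quadri /quadri_rev !hornerE !addnK -addnn !exprD !exprVn.
by field; rewrite x0 expf_neq0.
Qed.

(** A nonzero integer has square at least 1, so a sum of squares equal to 2 is 1 + 1. *)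
Lemma sum_sqr_int_eq2 (I : finType) (P : pred I) (f : I -> int) :
  \sum_(i | P i) f i ^+ 2 = 2 ->
  exists a b, [/\ P a && P b, a != b, f a ^+ 2 = 1, f b ^+ 2 = 1 &
    forall i, P i -> i != a -> i != b -> f i = 0].
Proof.
move=> sum2.
have nz (Q : pred I) : \sum_(i | Q i) f i ^+ 2 > 0 -> exists2 a, Q a & f a != 0.
  move=> gt0; have [a /andP[Qa fa]|none] := pickP [pred i | Q i && (f i != 0)].
    by exists a.
  move: gt0; rewrite big1 ?ltxx // => i Qi; move: (none i); rewrite /= Qi /=.
  by move/negbFE/eqP ->.
have ge0 (Q : pred I) : \sum_(i | Q i) f i ^+ 2 >= 0.
  by apply: sumr_ge0 => i _; exact: sqr_ge0.
have sq1 (z : int) : z != 0 -> z ^+ 2 <= 2 -> z ^+ 2 = 1.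
  rewrite expr2 => z0 zz; have [|] : z = 1 \/ z = -1 by nia.
    by move->.
  by move->.
have [|a Pa fa0] := nz P; first by rewrite sum2.
move: (sum2); rewrite (bigD1 a) //= => sum2a.
have fa : f a ^+ 2 = 1.
  by apply: sq1 => //; rewrite -sum2a lerDl; apply: ge0.
have sum1 : \sum_(i | P i && (i != a)) f i ^+ 2 = 1 by apply: (addrI (f a ^+ 2)); rewrite sum2a fa.
have [|b /andP[Pb ba] fb0] := nz (fun i => P i && (i != a)); first by rewrite sum1.
move: (sum1); rewrite (bigD1 b) /= ?Pb // => sum1b.
have fb : f b ^+ 2 = 1.
  by apply: sq1 => //; rewrite (@le_trans _ _ 1) // -sum1b lerDl; apply: ge0.
exists a, b; split=> //; first 1 [by rewrite Pa | by rewrite eq_sym].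
move=> i Pi ia ib; apply/eqP; apply: contraT => fi.
have : \sum_(i | (P i && (i != a)) && (i != b)) f i ^+ 2 = 0.
  by apply: (addrI (f b ^+ 2)); rewrite sum1b fb.
move/eqP; rewrite psumr_eq0 => [/allP/(_ i (mem_index_enum _))|j _]; last exact: sqr_ge0.
by rewrite Pi ia ib /= expf_eq0 /= (negPf fi).
Qed.

Lemma horner_trinomial_rev (M a b : nat) (x : rat) :
  (a <= M)%N -> (b <= M)%N -> x != 0 ->
  ('X^M - 'X^(M - a) + 'X^(M - b) + 1 : {poly rat}).[x] =
  x ^+ M * ('X^M - 'X^a + 'X^b + 1 : {poly rat}).[x^-1].
Proof.
move=> aM bM x0; rewrite !hornerE /= !exprB ?unitfE // !exprVn.
move: (x ^+ M) (x ^+ a) (x ^+ b) (expf_neq0 M x0) (expf_neq0 a x0) (expf_neq0 b x0).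
by move=> u v w u0 v0 w0; field; rewrite u0 v0 w0.
Qed.

(* In positive degrees the two autocorrelations agree as multisets of exponents;
   comparing the sums of these multisets gives a - b = 4. *)
Lemma trinomial_match (n a b : nat) : (2 < n)%N -> (0 < a < n.*2)%N -> (0 < b < n.*2)%N ->
  (b < a)%N ->
  (forall x : rat, x != 0 ->
     let F := 'X^(n.*2) - 'X^a + 'X^b + 1 : {poly rat} in
     F.[x] * F.[x^-1] = (quadri n).[x] * (quadri n).[x^-1]) ->
  a = (n + 2)%N /\ b = (n - 2)%N.
Proof.
set M := n.*2 => n_gt2 a_int b_int ltba FQ.
pose F : {poly rat} := 'X^M - 'X^a + 'X^b + 1.
pose F' : {poly rat} := 'X^M - 'X^(M - a) + 'X^(M - b) + 1.
have FF : F * F' = quadri n * quadri_rev n.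
  apply: poly_eq_horner_neq0 => x x0.
  rewrite !hornerM horner_quadri_rev 1?ltnW // mulrCA -FQ // mulrCA; congr (_ * _).
  by apply: horner_trinomial_rev => //; lia.
(* Coefficients of degree M + j in F F' and Q Q' are compared. Negative terms are moved across, so
   that both sides count exponents; exponents at most M do not contribute. *)
have count j : (0 < j)%N ->
    ((j == M - b) + (j == b) + (j == 4) = (j == M - a) + (j == a) + (j == a - b))%N.
  move=> j0; move/(congr1 (fun p : {poly rat} => p`_(M + j))): FF.
  rewrite /F /F' /quadri /quadri_rev -/M.
  rewrite !(mulrDl, mulrDr, mulrN, mulNr, mul1r, mulr1, opprK) -!exprD.
  rewrite !(coefD, coefN, coefXn, coef1).
  have cancel e : (M + j == M + e = (j == e))%N by lia.
  have small e : (e <= M)%N -> (M + j == e)%N = false by lia.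
  have -> : (a + (M - a) = M)%N by lia.
  have -> : (b + (M - b) = M)%N by lia.
  have -> : (a + (M - b) = M + (a - b))%N by lia.
  have -> : ((n + 2) + (n - 2) = M)%N by lia.
  have -> : ((n - 2) + (n + 2) = M)%N by lia.
  have -> : ((n + 2) + (n + 2) = M + 4)%N by lia.
  rewrite !(addnC _ M) !cancel !small; try lia.
  move=> H; apply/eqP; rewrite -(eqr_nat rat) !natrD; apply/eqP; lra.
have perm : perm_eq [:: (M - b)%N; b; 4] [:: (M - a)%N; a; (a - b)%N].
  apply/allP => j; rewrite !inE /= => jin; apply/eqP; rewrite !addn0 !addnA.
  rewrite !(eq_sym _ j) count //; lia.
have := perm_sumn perm; rewrite /= => sum_eq.
have ab : (a - b = 4)%N by lia.
(* So a is M - b, b or 4. Since 0 < b and a - b = 4, only a = M - b is left. *)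
have := perm_mem perm a; rewrite !inE eqxx orbT; lia.
Qed.

(** If b < a, [trinomial_match] applies to F. If a < b, it applies to the reversal of F, whose inner
    exponents are 2n - a > 2n - b and which has the same product with its own reversal. *)
Lemma trinomial_cases (n a b : nat) (F : {poly rat}) : (2 < n)%N ->
  (0 < a < n.*2)%N -> (0 < b < n.*2)%N -> a != b ->
  F = 'X^(n.*2) - 'X^a + 'X^b + 1 ->
  (forall x : rat, x != 0 ->
     F.[x] * F.[x^-1] = (quadri n).[x] * (quadri n).[x^-1]) ->
  F = quadri n \/ F = quadri_rev n.
Proof.
move=> n_gt2 aM bM ab FE FQ; have [ltba|leab] := ltnP b a.
  left; have [|aE bE] := @trinomial_match n a b n_gt2 aM bM ltba; last by rewrite FE aE bE.
  by move=> x x0 /=; rewrite -FE FQ.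
right; have [||||aE bE] := @trinomial_match n (n.*2 - a) (n.*2 - b) n_gt2; try lia.
  move=> x x0 F'; have F'E y : y != 0 -> F'.[y] = y ^+ n.*2 * F.[y^-1].
    by rewrite FE => y0; apply: horner_trinomial_rev => //; lia.
  rewrite !F'E ?invr_eq0 // invrK mulrACA -exprMn mulfV // expr1n mul1r.
  by rewrite mulrC FQ.
have -> : F = 'X^(n.*2) - 'X^(n - 2) + 'X^(n + 2) + 1.
  by rewrite FE; do ![congr (_ + _)]; [congr (- 'X^_) | congr 'X^_]; clear -aM bM aE bE n_gt2; lia.
by rewrite /quadri_rev; congr (_ + _); rewrite addrAC.
Qed.

(** The constant coefficient of F F' shows that both end coefficients of F equal one sign e, and the
    middle coefficient is the sum of squares 4. So exactly two inner coefficients are nonzero, and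
    they are signs as well. *)
Lemma quadri_autocorrelation n (F : {poly int}) : (2 < n)%N ->
  (size F <= (n.*2).+1)%N ->
  (forall x : rat, x != 0 -> let G := map_poly intr F in
     G.[x] * G.[x^-1] = (quadri n).[x] * (quadri n).[x^-1]) ->
  exists2 e : rat, e ^+ 2 = 1 &
    map_poly intr F = e *: quadri n \/ map_poly intr F = e *: quadri_rev n.
Proof.
move=> n_gt2 sF FQ; set G : {poly rat} := map_poly intr F.
have sG : (size G <= (n.*2).+1)%N by rewrite size_map_inj_poly //; exact: intr_inj.
have GG : G * revp n.*2 G = quadri n * quadri_rev n.
  apply: poly_eq_horner_neq0 => x x0.
  by rewrite !hornerM horner_revp // horner_quadri_rev 1?ltnW // mulrCA FQ // mulrCA.
have ends : F`_0 * F`_(n.*2) = 1.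
  apply: (@intr_inj rat); rewrite rmorphM /= -!coef_map -/G.
  move/(congr1 (fun p : {poly rat} => p`_0)): GG.
  rewrite !coef0M [(revp _ _)`_0]coef_poly subn0 => ->.
  have neq e : (0 < e)%N -> (0 == e)%N = false by case: e.
  rewrite /quadri /quadri_rev !(coefD, coefN, coefXn, coef1) !eqxx !neq; try lia.
  by rewrite /= !(addr0, add0r, subr0, oppr0) mulr1.
have sumsq : \sum_(i < (n.*2).+1) F`_i ^+ 2 = 4.
  apply: (@intr_inj rat); rewrite rmorph_sum /=.
  transitivity (G * revp n.*2 G)`_(n.*2).
    rewrite coefM; apply: eq_bigr => i _.
    rewrite [(revp _ _)`__]coef_poly ltnS leq_subr subKn -1?ltnS // -/G.
    by rewrite rmorphXn /= coef_map -expr2.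
  rewrite GG /quadri /quadri_rev.
  rewrite !(mulrDl, mulrDr, mulrN, mulNr, mul1r, mulr1, opprK) -!exprD.
  rewrite !(coefD, coefN, coefXn, coef1).
  have neq e : e != n.*2 -> (n.*2 == e)%N = false by move/negbTE; rewrite eq_sym.
  have -> : ((n + 2) + (n - 2) = n.*2)%N by lia.
  have -> : ((n - 2) + (n + 2) = n.*2)%N by lia.
  rewrite eqxx !neq; try lia.
  by rewrite /= !(addr0, add0r, subr0, oppr0).
have [e ee [F0 FM]] : exists2 e : int, e ^+ 2 = 1 & F`_0 = e /\ F`_(n.*2) = e.
  have/eqP := congr1 absz ends; rewrite abszM muln_eq1 => /andP[/eqP F0 _].
  have [E|E] : F`_0 = 1 \/ F`_0 = -1 by lia.
    by exists 1 => //; split=> //; rewrite -ends E mul1r.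
  by exists (-1) => //; split=> //; rewrite -ends E mulN1r opprK.
have sum2 : \sum_(i < (n.*2).+1 | (0 < i < n.*2)%N) F`_i ^+ 2 = 2.
  move: sumsq; rewrite (bigD1 ord0) //= (bigD1 ord_max) /=; last first.
    by rewrite -val_eqE /=; lia.
  rewrite F0 FM ee => sum2; apply: (addrI (1 + 1)); rewrite -addrA -[RHS]sum2.
  congr (_ + (_ + _)); apply: eq_bigl => i; rewrite -!val_eqE /=.
  by have := ltn_ord i; lia.
have [a [b [/andP[aM bM] ab fa fb rest]]] := sum_sqr_int_eq2 sum2.
have e2 : (e%:~R : rat) ^+ 2 = 1 by rewrite -rmorphXn ee.
pose f (i : nat) : rat := e%:~R * (F`_i)%:~R.
have f2 i : F`_i ^+ 2 = 1 -> f i ^+ 2 = 1.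
  by move=> fi; rewrite exprMn e2 mul1r -rmorphXn fi.
(* Multiplication by e turns both end coefficients into 1. *)
pose H := e%:~R *: G.
have HE : H = 'X^(n.*2) + f a *: 'X^a + f b *: 'X^b + 1.
  apply/polyP => i; rewrite !(coefD, coefZ, coefXn, coef1, coef_map) /=.
  have [iM|iM] := leqP i n.*2; last first.
    rewrite nth_default; last by apply: leq_trans sF _.
    by do 4! [rewrite (_ : (i == _) = false); last lia]; rewrite /= rmorph0 !mulr0 !addr0.
  have [->|i0] := eqVneq i 0%N.
    rewrite F0 -expr2 e2 eq_sym.
    by do 3! [rewrite (_ : (_ == _)%N = false); last lia]; rewrite /= !mulr0 !add0r.
  have [->|iM'] := eqVneq i n.*2.
    rewrite FM -expr2 e2.
    by do 2! [rewrite (_ : (_ == _)%N = false); last lia]; rewrite /= !mulr0 !addr0.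
  have [->|ia] := eqVneq i a.
    have -> : (a == b :> nat) = false by apply/negbTE.
    by rewrite mulr1 mulr0 !addr0 add0r.
  have [->|ib] := eqVneq i b; first by rewrite mulr1 mulr0 !addr0 !add0r.
  have io : (i < (n.*2).+1)%N by [].
  by rewrite (rest (Ordinal io)) ?rmorph0 ?mulr0 ?addr0 -?val_eqE //=; lia.
have HQ x : x != 0 -> H.[x] * H.[x^-1] = (quadri n).[x] * (quadri n).[x^-1].
  by move=> x0; rewrite !hornerZ mulrACA -expr2 e2 mul1r FQ.
(* At x = 1 the identity reads (2 + f a + f b)^2 = 4, which two equal signs violate. *)
have fab : f b = - f a.
  have := HQ 1 (oner_neq0 _); rewrite invr1 HE /quadri !hornerE !expr1n.
  move: (f2 a fa) (f2 b fb) => /eqP; rewrite sqrf_eq1 => /orP[]/eqP-> /eqP;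
    rewrite sqrf_eq1 => /orP[]/eqP->; lra.
exists e%:~R => //.
suff HH : H = quadri n \/ H = quadri_rev n.
  have -> : G = e%:~R *: H by rewrite scalerA -expr2 e2 scale1r.
  by case: HH => ->; [left|right].
have abN : a != b :> nat by [].
have := f2 a fa => /eqP; rewrite sqrf_eq1 => /orP[]/eqP fa1.
  apply: (@trinomial_cases n b a) => //; first by rewrite eq_sym.
  by rewrite HE fab fa1 scale1r scaleN1r; congr (_ + _); rewrite addrAC.
apply: (@trinomial_cases n a b) => //.
by rewrite HE fab fa1 opprK scale1r scaleN1r.
Qed.

(** * Factorisation of Q over the rationals *)

Lemma size_quadri n : (2 < n)%N -> size (quadri n) = (n.*2).+1.
Proof.
move=> n_gt2; rewrite /quadri -!addrA size_polyDl size_polyXn // ltnS.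
apply: leq_trans (size_polyD _ _) _; rewrite geq_max size_polyN size_polyXn.
apply/andP; split; first by lia.
apply: leq_trans (size_polyD _ _) _; rewrite geq_max size_polyXn size_poly1; lia.
Qed.

Lemma revp_mul (F : numFieldType) (d1 d2 : nat) (p q : {poly F}) :
  (size p <= d1.+1)%N -> (size q <= d2.+1)%N ->
  revp (d1 + d2) (p * q) = revp d1 p * revp d2 q.
Proof.
move=> sp sq; apply: poly_eq_horner_neq0 => x x0.
rewrite !(hornerM, horner_revp) //; first by rewrite exprD mulrACA.
apply: leq_trans (size_polyMleq _ _) _.
by rewrite -subn1 leq_subLR (leq_trans (leq_add sp sq)) // addSn addnS.
Qed.

(** Ljunggren's trick for F = P' R, where P' and R' are the reversals of P and R: F = e Q gives P' =
    e P, and F = e Q' gives R = e R'. So P or R divides P' R' = Q'. *)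
Lemma quadri_factor n (q r : {poly rat}) : (2 < n)%N -> quadri n = q * r ->
  q %| quadri_rev n \/ r %| quadri_rev n.
Proof.
move=> n_gt2 Qqr.
have Q0 : quadri n != 0 by rewrite -size_poly_eq0 size_quadri.
pose QZ : {poly int} := 'X^(n.*2) - 'X^(n + 2) + 'X^(n - 2) + 1.
have QZE : map_poly intr QZ = quadri n.
  by rewrite /QZ /quadri !(rmorphD, rmorphN, rmorph1) /= !map_polyXn.
(* By Gauss's lemma the factors can be taken in Z[t], where the squares of the coefficients are
   integers. *)
have [|p1 [a a0 qE] [r1 QZpr]] := @dvdpP_rat_int q QZ.
  by rewrite QZE Qqr dvdp_mulr.
set P : {poly rat} := map_poly intr p1 in qE.
pose R1 : {poly rat} := map_poly intr r1.
have QPR : quadri n = P * R1 by rewrite -QZE QZpr rmorphM.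
have P0 : P != 0 by apply: contraNneq Q0 => P0; rewrite QPR P0 mul0r.
have R0 : R1 != 0 by apply: contraNneq Q0 => R0; rewrite QPR R0 mulr0.
have rE : r = a^-1 *: R1.
  apply: (mulfI (_ : q != 0)); first by rewrite qE scaler_eq0 negb_or a0.
  by rewrite -Qqr QPR qE -scalerAl -scalerAr scalerA mulfV // scale1r.
pose d1 := (size P).-1; pose d2 := (size R1).-1.
have sP : (size P <= d1.+1)%N by rewrite leqSpred.
have sR : (size R1 <= d2.+1)%N by rewrite leqSpred.
have dd : (d1 + d2 = n.*2)%N.
  have p0 : (0 < size P)%N by rewrite size_poly_gt0.
  have r0 : (0 < size R1)%N by rewrite size_poly_gt0.
  have := size_quadri n_gt2; rewrite QPR size_mul //.
  by rewrite -(prednK p0) -(prednK r0) addSn addnS => -[].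
have QrevE : quadri_rev n = revp d1 P * revp d2 R1.
  rewrite -revp_mul // dd -QPR; apply: poly_eq_horner_neq0 => x x0.
  by rewrite horner_revp ?size_quadri // horner_quadri_rev // ltnW.
have FE : map_poly intr (revp d1 p1 * r1) = revp d1 P * R1.
  by rewrite rmorphM /= map_revp.
have [|x x0|e e2] := @quadri_autocorrelation n (revp d1 p1 * r1) n_gt2.
- apply: leq_trans (size_polyMleq _ _) _.
  have -> : size r1 = size R1 by rewrite size_map_inj_poly //; exact: intr_inj.
  rewrite -subn1 leq_subLR (leq_trans (leq_add (size_revp d1 p1) sR)) //.
  by rewrite addSn addnS dd.
- rewrite /= FE QPR !hornerM !horner_revp ?invr_eq0 // invrK.
  have xx : x ^+ d1 * x^-1 ^+ d1 = 1 by rewrite -exprMn mulfV // expr1n.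
  move: xx; move: (x ^+ d1) (x^-1 ^+ d1) P.[x] P.[x^-1] R1.[x] R1.[x^-1].
  move=> u v p p' r' r'' uv; rewrite -[RHS]mul1r -uv; clear; ring.
rewrite FE => -[] E.
  left; rewrite QrevE; have : revp d1 P = e *: P.
    by apply: (mulIf R0); rewrite E QPR scalerAl.
  by move=> ->; rewrite qE dvdpZl // -scalerAl dvdpZr ?dvdp_mulr //;
    apply: contra_eq_neq e2 => ->; rewrite expr0n.
right; rewrite rE dvdpZl ?invr_eq0 //.
have rP0 : revp d1 P != 0.
  apply: contraTneq isT => rP0.
  have /(congr1 (horner^~ 0)) : quadri_rev n = 0 by rewrite QrevE rP0 mul0r.
  rewrite horner0 /quadri_rev !(hornerD, hornerN, hornerXn) hornerC !expr0n.

  have neq k : (0 < k)%N -> (k == 0)%N = false by case: k.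
  rewrite !neq; try lia; rewrite /= !(addr0, subr0, add0r).
  by move/eqP; rewrite oner_eq0.
have : R1 = e *: revp d2 R1.
  by apply: (mulfI rP0); rewrite E QrevE scalerAr.
move=> R1E; rewrite QrevE dvdp_mull // {1}R1E dvdpZl //.
by apply: contra_eq_neq e2 => ->; rewrite expr0n.
Qed.

Definition sqr_add1 : {poly rat} := 'X^2 + 1.

(** Such a q divides Q + Q' = 2 (t^(2n) + 1) and Q' - Q = 2 t^(n-2) (t^4 - 1), and is coprime to t.
    Modulo q, t^4 is 1, so t^(2n) is 1 or t^2 according to the parity of n. *)
Lemma quadri_common n (q : {poly rat}) : (2 < n)%N ->
  q %| quadri n -> q %| quadri_rev n -> q %| (if odd n then sqr_add1 else 1).
Proof.
move=> n_gt2 qQ qR; have two0 : (2 : rat) != 0 by [].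
have q1 : q %| 'X^(n.*2) + 1.
  have := dvdp_add qQ qR; suff -> : quadri n + quadri_rev n = 2 *: ('X^(n.*2) + 1).
    by rewrite dvdpZr.
  rewrite /quadri /quadri_rev -[RHS]/((1 + 1) *: _) scalerDl !scale1r.
  by move: 'X^(n.*2) 'X^(n + 2) 'X^(n - 2) => u v w; ring.
have q2 : q %| 'X^(n - 2) * ('X^4 - 1).
  have := dvdp_sub qR qQ.
  suff -> : quadri_rev n - quadri n = 2 *: ('X^(n - 2) * ('X^4 - 1)).
    by rewrite dvdpZr.
  rewrite /quadri /quadri_rev -[RHS]/((1 + 1) *: _) scalerDl !scale1r.
  rewrite mulrBr mulr1 -exprD (_ : n - 2 + 4 = n + 2)%N; last by lia.
  by move: 'X^(n.*2) 'X^(n + 2) 'X^(n - 2) => u v w; ring.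
have qX : coprimep q 'X.
  apply: (coprimep_dvdr q1); rewrite coprimepX /root !(hornerD, hornerXn) hornerC.
  by rewrite expr0n; case: n n_gt2 {qQ qR q1 q2}.
have {}q2 : q %| 'X^4 - 1 by rewrite Gauss_dvdpr ?coprimep_expr in q2.
have q3 k : q %| 'X^(4 * k) - 1.
  by rewrite exprM subrX1 dvdp_mulr.
have := odd_double_half n; case: ifP => _ nE; last first.
  have : q %| ('X^(n.*2) + 1) - ('X^(4 * n./2) - 1) by apply: dvdp_sub.
  rewrite (_ : 4 * n./2 = n.*2)%N; last by lia.
  have -> : 'X^(n.*2) + 1 - ('X^(n.*2) - 1) = 2 *: 1 :> {poly rat}.
    rewrite -[RHS]/((1 + 1) *: _) scalerDl !scale1r.
    by move: 'X^(n.*2) => u; ring.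
  by rewrite dvdpZr.
have : q %| ('X^(n.*2) + 1) - 'X^2 * ('X^(4 * n./2) - 1).
  by apply: dvdp_sub => //; apply: dvdp_mull.
rewrite mulrBr mulr1 -exprD (_ : 2 + 4 * n./2 = n.*2)%N; last by lia.
rewrite /sqr_add1 (_ : _ - _ = 'X^2 + 1) //.
by move: 'X^(n.*2) 'X^2 => u v; ring.
Qed.

Lemma sqr_add1_dvd_X4 k : sqr_add1 %| 'X^(4 * k) - 1.
Proof.
rewrite exprM subrX1 dvdp_mulr // (_ : 'X^4 - 1 = sqr_add1 * ('X^2 - 1)) ?dvdp_mulIl //.
by rewrite /sqr_add1 (exprM _ 2 2); move: 'X^2 => u; ring.
Qed.

Lemma sqr_add1_dvd_X4D2 k : sqr_add1 %| 'X^(4 * k + 2) + 1.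
Proof.
rewrite (_ : _ + 1 = 'X^2 * ('X^(4 * k) - 1) + sqr_add1); last first.
  by rewrite exprD /sqr_add1; move: 'X^(4 * k) 'X^2 => u v; ring.
by rewrite dvdp_add // dvdp_mull // sqr_add1_dvd_X4.
Qed.

(** The common factor of Q and Q'; for odd n it is the fourth cyclotomic polynomial. *)
Definition quadri_cyc n : {poly rat} := if odd n then sqr_add1 else 1.
Definition quadri_core n : {poly rat} := quadri n %/ quadri_cyc n.

Lemma quadriE n : (2 < n)%N -> quadri n = quadri_cyc n * quadri_core n.
Proof.
move=> n_gt2; rewrite /quadri_core mulrC divpK // /quadri_cyc.
case: ifP => [n_odd|_]; last exact: dvd1p.
have -> : quadri n = ('X^(4 * n./2 + 2) + 1) - 'X^(n - 2) * ('X^(4 * 1) - 1).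
  rewrite mulrBr mulr1 -exprD (_ : 4 * n./2 + 2 = n.*2)%N; last by lia.
  rewrite (_ : n - 2 + 4 * 1 = n + 2)%N; last by lia.
  by rewrite /quadri; move: 'X^(n.*2) 'X^(n - 2) 'X^(n + 2) => u v w; ring.
by rewrite dvdp_sub // ?dvdp_mull ?sqr_add1_dvd_X4 ?sqr_add1_dvd_X4D2.
Qed.

Lemma size_sqr_add1 : size sqr_add1 = 3.
Proof. by rewrite size_polyDl size_polyXn ?size_poly1. Qed.

Lemma size_quadri_cyc n : size (quadri_cyc n) = (odd n).*2.+1.
Proof. by rewrite /quadri_cyc; case: odd; rewrite ?size_sqr_add1 ?size_poly1. Qed.

Lemma quadri_cyc_neq0 n : quadri_cyc n != 0.
Proof. by rewrite -size_poly_eq0 size_quadri_cyc. Qed.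

Lemma quadri_core_neq0 n : (2 < n)%N -> quadri_core n != 0.
Proof.
move=> n_gt2; apply: contraTneq isT => c0; have := size_quadri n_gt2.
by rewrite quadriE // c0 mulr0 size_poly0.
Qed.

Lemma size_quadri_core n : (2 < n)%N -> size (quadri_core n) = (n - odd n).*2.+1.
Proof.
move=> n_gt2; have := size_quadri n_gt2; rewrite quadriE // size_mul //.
- rewrite size_quadri_cyc addSn /=; move: (size _) => s; lia.
- exact: quadri_cyc_neq0.
- exact: quadri_core_neq0.
Qed.

(** For odd n this says that t^2 + 1 is a simple factor of Q. A common divisor g divides t^2 + 1 and
    the derivative of Q, hence n + 2 t^(n-2). As t^(2(n-2)) is -1 modulo t^2 + 1, multiplying by n -
    2 t^(n-2) shows that g divides the constant n^2 + 4. *)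
Lemma coprimep_quadri_core_cyc n : (2 < n)%N -> coprimep (quadri_core n) (quadri_cyc n).
Proof.
move=> n_gt2; have [n_odd|n_even] := boolP (odd n); last first.
  by rewrite /quadri_cyc (negPf n_even) coprimep1.
have E := quadriE n_gt2; rewrite /quadri_cyc n_odd in E *.
set g := gcdp (quadri_core n) sqr_add1.
have gC : g %| quadri_core n by apply: dvdp_gcdl.
have gA : g %| sqr_add1 by apply: dvdp_gcdr.
have gQ' : g %| (quadri n)^`().
  by rewrite E derivM; apply: dvdp_add; [apply: dvdp_mull|apply: dvdp_mulr].
pose N : {poly rat} := n%:R; pose Y : {poly rat} := 'X^(n - 2).
have XdX k : (0 < k)%N -> 'X * ('X^k)^`() = k%:R * 'X^k :> {poly rat}.
  by move=> k0; rewrite derivXn mulrnAr -exprS prednK // mulr_natl.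
have XQ' : 'X * (quadri n)^`() =
    2 * N * ('X^(4 * n./2 + 2) + 1) - (N + 2) * (Y * ('X^(4 * 1) - 1)) - (N + 2 * Y) *+ 2.
  rewrite /quadri !(derivD, derivN, derivC) addr0 mulrDr mulrBr !XdX; try lia.
  rewrite mulrBr mulr1 -exprD (_ : 4 * n./2 + 2 = n.*2)%N; last by lia.
  rewrite (_ : n - 2 + 4 * 1 = n + 2)%N; last by lia.
  rewrite -muln2 !natrM natrD natrB ?(ltnW n_gt2) // -/N -/Y.
  by move: 'X^(_ * _) Y 'X^(n + 2) N => u v w t; ring.
have gL : g %| N + 2 * Y.
  rewrite -(@dvdpZr _ 2) // scaler_nat.
  rewrite (_ : (N + 2 * Y) *+ 2 = 2 * N * ('X^(4 * n./2 + 2) + 1) -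
    (N + 2) * (Y * ('X^(4 * 1) - 1)) - 'X * (quadri n)^`()).
    apply: dvdp_sub; last exact: dvdp_mull.
    apply: dvdp_trans gA _; apply: dvdp_sub; apply: dvdp_mull.
      exact: sqr_add1_dvd_X4D2.
    by apply: dvdp_mull; exact: sqr_add1_dvd_X4.
  by rewrite XQ' subKr.
have : g %| (N + 2 * Y) * (N - 2 * Y) + 4 * ('X^(4 * (n./2 - 1) + 2) + 1).
  apply: dvdp_add; first exact: dvdp_mulr.
  by apply: dvdp_trans gA _; apply: dvdp_mull; exact: sqr_add1_dvd_X4D2.
have -> : (N + 2 * Y) * (N - 2 * Y) + 4 * ('X^(4 * (n./2 - 1) + 2) + 1) =
    (n%:R ^+ 2 + 4)%:P.
  rewrite (_ : 4 * (n./2 - 1) + 2 = (n - 2) + (n - 2))%N; last by lia.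
  rewrite exprD polyCD polyC_exp !polyC_natr -/N -/Y.
  by move: (N) (Y) => u v; ring.
move=> gN; rewrite /coprimep -/g -dvdp1.
have c0 : (n%:R ^+ 2 + 4 : rat) != 0 by rewrite -natrX -natrD pnatr_eq0 addn4.
by move: gN; rewrite -[_%:P]mulr1 mul_polyC dvdpZr.
Qed.

(** A factorisation q r of the core splits Q into q and [quadri_cyc n] times r. One of these divides
    Q', hence divides [quadri_cyc n]. In the first case q, being coprime to [quadri_cyc n], is
    constant; in the second r is. *)
Lemma quadri_core_irreducible n : (2 < n)%N -> irreducible_poly (quadri_core n).
Proof.
move=> n_gt2; split; first by rewrite size_quadri_core // ltnS double_gt0; case: odd; lia.
move=> q sq qC; have cop := coprimep_quadri_core_cyc n_gt2.
have CE : quadri_core n = q * (quadri_core n %/ q) by rewrite mulrC divpK.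
move: (quadri_core n %/ q) CE => r CE.
have QE : quadri n = q * (quadri_cyc n * r) by rewrite quadriE // CE mulrCA.
have := quadri_factor n_gt2 QE => -[] dv.
  have qA : q %| quadri_cyc n by apply: quadri_common; rewrite // QE dvdp_mulr.
  by move: sq; rewrite size_poly_eq1 (coprimepP _ _ cop).
have : quadri_cyc n * r %| quadri_cyc n.
  by apply: quadri_common; rewrite // QE dvdp_mull.
rewrite -{2}[quadri_cyc n]mulr1 dvdp_mul2l ?quadri_cyc_neq0 // dvdp1 => r1.
by rewrite /eqp qC CE -{2}[q]mulr1 dvdp_mul // dvdp1.
Qed.

Definition quadri_core_rev n : {poly rat} := revp (n - odd n).*2 (quadri_core n).

Lemma quadri_revE n : (2 < n)%N -> quadri_rev n = quadri_cyc n * quadri_core_rev n.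
Proof.
move=> n_gt2; have -> : quadri_rev n = revp n.*2 (quadri n).
  apply: poly_eq_horner_neq0 => x x0.
  by rewrite horner_revp ?size_quadri // horner_quadri_rev // ltnW.
rewrite quadriE // (_ : n.*2 = (odd n).*2 + (n - odd n).*2)%N; last by case: odd; lia.
rewrite revp_mul ?size_quadri_cyc ?size_quadri_core //; congr (_ * _).
rewrite /quadri_cyc; case: odd; apply: poly_eq_horner_neq0 => x x0.
  rewrite horner_revp ?size_sqr_add1 // /sqr_add1 !hornerE; field.
  by rewrite x0.
by rewrite horner_revp ?size_poly1 // !hornerC mul1r.
Qed.

Lemma coprimep_quadri_core_rev n : (2 < n)%N ->
  coprimep (quadri_core n) (quadri_core_rev n).
Proof.
move=> n_gt2; apply/coprimepP => g gC gR.
apply: (coprimepP _ _ (coprimep_quadri_core_cyc n_gt2)) => //.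
apply: quadri_common => //; first by rewrite quadriE // dvdp_mull.
by rewrite quadri_revE // dvdp_mull.
Qed.

(** * Irreducibility of phat *)

(** The polynomial t^(2d) g(t^2 + t^-2), expanded so that no negative power of t occurs. *)
Definition lift_poly (d : nat) (g : {poly rat}) : {poly rat} :=
  \sum_(i < d.+1) g`_i *: (('X^4 + 1) ^+ i * 'X^((d - i).*2)).

Lemma horner_lift_poly d (g : {poly rat}) x : (size g <= d.+1)%N -> x != 0 ->
  (lift_poly d g).[x] = x ^+ d.*2 * g.[x ^+ 2 + x ^- 2].
Proof.
move=> sg x0; rewrite horner_sum (horner_coef_wide _ sg) mulr_sumr.
apply: eq_bigr => i _; rewrite hornerZ hornerM horner_exp hornerD !hornerXn hornerC.
rewrite [RHS]mulrCA; congr (_ * _).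
have id : (i <= d)%N by rewrite -ltnS.
have -> : x ^+ 4 + 1 = x ^+ 2 * (x ^+ 2 + x ^- 2).
  by rewrite mulrDr -exprD mulfV ?expf_neq0.
by rewrite exprMn -exprM mul2n mulrAC -exprD doubleB subnKC // leq_double.
Qed.

Lemma size_lift_poly d g : (size (lift_poly d g) <= (4 * d).+1)%N.
Proof.
apply: leq_trans (size_sum _ _ _) _; apply/bigmax_leqP => i _.
apply: leq_trans (size_scale_leq _ _) _; apply: leq_trans (size_polyMleq _ _) _.
rewrite size_polyXn.
have s4 : size ('X^4 + 1 : {poly rat}) = 5 by rewrite size_polyDl size_polyXn ?size_poly1.
have := size_exp_leq ('X^4 + 1 : {poly rat}) i; rewrite s4 /=.
by move: (size _) => s; have := ltn_ord i; lia.
Qed.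

Lemma lift_polyM d e (g h : {poly rat}) : (size g <= d.+1)%N -> (size h <= e.+1)%N ->
  lift_poly (d + e) (g * h) = lift_poly d g * lift_poly e h.
Proof.
move=> sg sh; have sgh : (size (g * h)%R <= (d + e).+1)%N.
  apply: leq_trans (size_polyMleq _ _) _.
  by rewrite -subn1 leq_subLR (leq_trans (leq_add sg sh)) // addSn addnS.
apply: poly_eq_horner_neq0 => x x0.
rewrite hornerM (horner_lift_poly sg x0) (horner_lift_poly sh x0).
by rewrite (horner_lift_poly sgh x0) doubleD exprD hornerM mulrACA.
Qed.

Lemma revp_lift_poly d (g : {poly rat}) : (size g <= d.+1)%N ->
  revp (4 * d) (lift_poly d g) = lift_poly d g.
Proof.
move=> sg; apply: poly_eq_horner_neq0 => x x0.
rewrite horner_revp ?size_lift_poly // !horner_lift_poly ?invr_eq0 //.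
rewrite -!exprVn invrK [x^-1 ^+ 2 + _]addrC mulrA; congr (_ * _).
rewrite (_ : 4 * d = d.*2 + d.*2)%N; last by lia.
by rewrite exprD -mulrA -exprMn mulfV // expr1n mulr1.
Qed.

Lemma size_quadri_rev n : (2 < n)%N -> size (quadri_rev n) = (n.*2).+1.
Proof.
move=> n_gt2; rewrite /quadri_rev -!addrA size_polyDl size_polyXn // ltnS.
apply: leq_trans (size_polyD _ _) _; rewrite geq_max size_polyXn.
apply/andP; split; first by lia.
apply: leq_trans (size_polyD _ _) _.
rewrite geq_max size_polyN size_polyXn size_poly1; lia.
Qed.

Lemma quadri_core_rev_neq0 n : (2 < n)%N -> quadri_core_rev n != 0.
Proof.
move=> n_gt2; apply: contraTneq isT => c0; have := size_quadri_rev n_gt2.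
by rewrite quadri_revE // c0 mulr0 size_poly0.
Qed.

Lemma size_quadri_core_rev n : (2 < n)%N ->
  size (quadri_core_rev n) = (n - odd n).*2.+1.
Proof.
move=> n_gt2; have := size_quadri_rev n_gt2; rewrite quadri_revE // size_mul //.
- rewrite size_quadri_cyc addSn /=; move: (size _) => s; lia.
- exact: quadri_cyc_neq0.
- exact: quadri_core_rev_neq0.
Qed.

(** The lift is self-reciprocal, so the reversed core divides it too. The core and its reversal are
    coprime of degree 2 (n - odd n), while the lift has degree at most 4 d. *)
Lemma quadri_core_dvd_lift n d (g : {poly rat}) : (2 < n)%N ->
  (size g <= d.+1)%N -> lift_poly d g != 0 ->
  quadri_core n %| lift_poly d g -> (n - odd n <= d)%N.
Proof.
move=> n_gt2 sg L0 dvC; set D := (n - odd n).*2.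
have sC : size (quadri_core n) = D.+1 by rewrite size_quadri_core.
have [s LE] : exists s, lift_poly d g = quadri_core n * s.
  by exists (lift_poly d g %/ quadri_core n); rewrite mulrC divpK.
have s0 : s != 0 by apply: contraNneq L0 => s0; rewrite LE s0 mulr0.
have sL : (D + size s <= (4 * d).+1)%N.
  have := size_lift_poly d g; rewrite LE size_mul ?quadri_core_neq0 //.
  by rewrite sC addSn.
have ss : (size s <= (4 * d - D).+1)%N.
  by move: sL; move: (size s) => u; clear; lia.
have D4 : (D + (4 * d - D) = 4 * d)%N.
  by move: sL s0; rewrite -size_poly_gt0; move: (size s) => u; clear; lia.
have dvR : quadri_core_rev n %| lift_poly d g.
  rewrite -revp_lift_poly // LE -D4 revp_mul ?sC //.
  by rewrite dvdp_mulr.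
have : quadri_core n * quadri_core_rev n %| lift_poly d g.
  by rewrite Gauss_dvdp ?dvC // coprimep_quadri_core_rev.
move=> /(dvdp_leq L0).
rewrite size_mul ?quadri_core_neq0 ?quadri_core_rev_neq0 // sC.
rewrite size_quadri_core_rev // -/D addSn addnS /= => /leq_trans/(_ (size_lift_poly d g)).
by rewrite ltnS /D; clear; lia.
Qed.

(** * The polynomials p_n and their lifts *)

Lemma fpolyN k : fpoly (- k) = - fpoly k.
Proof.
case: k => [[|m]|m]; first by rewrite oppr0 /= oppr0.
  by rewrite -NegzE.
by rewrite NegzE opprK /= opprK.
Qed.

Lemma ppolyN n : ppoly (- n) = ppoly n.
Proof.
rewrite /ppoly -[in RHS](opprK (n - 1)) -[in RHS](opprK (n + 1)).
rewrite ![fpoly (- - _)]fpolyN !opprD !opprK.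
by congr (_ - _ + _); rewrite addrC.
Qed.

Lemma phatN n : phat (- n) = phat n.
Proof. by rewrite /phat ppolyN abszN. Qed.

Lemma ppoly_nat n : (0 < n)%N ->
  ppoly n = (fib_pair n.+1).1 - (fib_pair n.-1).1 - 'X^2 + 6%:R%:P.
Proof.
case: n => // n _; rewrite /ppoly -PoszD addn1.
by rewrite (_ : n.+1%:Z - 1 = n) // -addn1 PoszD addrK.
Qed.

(** With y = s + 1/s both sides satisfy u_(m+1) = y u_m - u_(m-1), so the induction carries two
    consecutive cases. *)
Lemma horner_lucas (F : fieldType) (f : {rmorphism rat -> F}) (m : nat) (s : F) : s != 0 ->
  (map_poly f ((fib_pair m.+2).1 - (fib_pair m).1)).[s + s^-1] = s ^+ m.+1 + s ^- m.+1.
Proof.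
move=> s0.
suff H k : (map_poly f ((fib_pair k.+2).1 - (fib_pair k).1)).[s + s^-1] = s ^+ k.+1 + s ^- k.+1 /\
 (map_poly f ((fib_pair k.+3).1 - (fib_pair k.+1).1)).[s + s^-1] = s ^+ k.+2 + s ^- k.+2.
  by have [] := H m.
elim: k => [|k [IH1 IH2]].
  rewrite !fib_pairSS /= !(rmorphB, rmorphM, rmorph1, rmorph0, map_polyX) /= !hornerE.
  by rewrite ?map_polyX ?hornerX; split; field; rewrite s0.
split => //.
have -> : (fib_pair k.+4).1 - (fib_pair k.+2).1 = 'X * ((fib_pair k.+3).1 - (fib_pair k.+1).1)
  - ((fib_pair k.+2).1 - (fib_pair k).1).
  rewrite [in LHS]fib_pairSS [X in _ - X = _]fib_pairSS.
  by move: (fib_pair k.+3).1 (fib_pair k.+2).1 (fib_pair k.+1).1 (fib_pair k).1 => *; ring.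
rewrite [map_poly _ _]rmorphB rmorphM /= map_polyX hornerD hornerN hornerM hornerX IH1 IH2.
rewrite !exprS; move: (s ^+ k) (expf_neq0 k s0) => u u0; field.
by rewrite u0 s0.
Qed.

Lemma fib_monic m : size (fib_pair m.+1).1 = m.+1 /\ (fib_pair m.+1).1 \is monic.
Proof.
suff : [/\ (size (fib_pair m).1 <= m)%N, size (fib_pair m.+1).1 = m.+1 &
   (fib_pair m.+1).1 \is monic] by case.
elim: m => [|m [IH1 IH2 IH3]].
  by rewrite /= size_poly0 size_poly1 monic1.
have sX : size ('X * (fib_pair m.+1).1) = m.+2.
  by rewrite mulrC size_mulX ?IH2 // monic_neq0.
have lt : (size (- (fib_pair m).1) < size ('X * (fib_pair m.+1).1)%R)%N.
  by rewrite size_polyN sX ltnS (leq_trans IH1).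
rewrite fib_pairSS; split; first by rewrite IH2.
  by rewrite size_polyDl.
by rewrite monicE lead_coefDl // lead_coef_Mmonic ?lead_coefX // -?monicE.
Qed.

Lemma ppoly_nat_monic n : (2 < n)%N -> size (ppoly n) = n.+1 /\ ppoly n \is monic.
Proof.
move=> n_gt2; rewrite ppoly_nat; last by lia.
have [s1 m1] := fib_monic n.
have lt : (size (- (fib_pair n.-1).1 + (- 'X^2 + 6%:R%:P))%R < size (fib_pair n.+1).1)%N.
  rewrite s1 ltnS; apply: leq_trans (size_polyD _ _) _; rewrite geq_max size_polyN.
  apply/andP; split.
    by have [+ _] := fib_monic n.-2; rewrite (_ : n.-2.+1 = n.-1) => [->|]; lia.
  apply: leq_trans (size_polyD _ _) _; rewrite geq_max size_polyN size_polyXn n_gt2.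
  by apply: leq_trans (size_polyC_leq1 _) _; lia.
rewrite -!addrA; split; first by rewrite size_polyDl.
by rewrite monicE lead_coefDl // -monicE.
Qed.

Lemma phat_nat_monic n : (2 < n)%N ->
  size (phat n) = (n - odd n).+1 /\ phat n \is monic.
Proof.
move=> n_gt2; have [sp mp] := ppoly_nat_monic n_gt2.
have [n_odd|n_even] := boolP (odd n); last first.
  by rewrite /phat /= (negPf n_even) subn0.
have E : ppoly n = ('X + 2%:R%:P) * phat n by apply: phatP.
have X2 : 'X + 2%:R%:P = 'X - (- 2%:R)%:P :> {poly rat} by rewrite polyCN opprK.
have m2 : 'X + 2%:R%:P \is @monic rat by rewrite X2 monicXsubC.
have mh : phat n \is monic by move: mp; rewrite E monicMl.
split=> //; move: sp; rewrite E size_Mmonic ?monic_neq0 // X2 size_XsubC.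
by move: (size _) => s; lia.
Qed.

Lemma horner_ppoly (F : fieldType) (f : {rmorphism rat -> F}) n (s : F) :
  (0 < n)%N -> s != 0 ->
  (map_poly f (ppoly n)).[s + s^-1] = s ^+ n + s ^- n - (s + s^-1) ^+ 2 + 6%:R.
Proof.
case: n => // n _ s0; rewrite ppoly_nat //.
rewrite rmorphD [X in X + _]rmorphB /= map_polyXn map_polyC /= rmorph_nat.
rewrite !(hornerD, hornerN, hornerXn, hornerC).
by rewrite horner_lucas.
Qed.

Lemma lift_ppoly n : (2 < n)%N -> lift_poly n (ppoly n) = quadri n * quadri_rev n.
Proof.
move=> n_gt2; have [sp _] := ppoly_nat_monic n_gt2.
apply: poly_eq_horner_neq0 => x x0.
rewrite hornerM horner_quadri_rev 1?ltnW // horner_lift_poly ?sp //.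
have := @horner_ppoly rat idfun n (x ^+ 2); rewrite map_poly_id // expf_neq0 //.
move=> -> //; last by lia.
rewrite /quadri !(hornerD, hornerN, hornerXn, hornerC) !exprVn -!exprM.
have -> : (2 * n = n.*2)%N by lia.
have -> : (n + 2 = n - 2 + 4)%N by lia.
have -> : n.*2 = (n - 2 + (n - 2) + 4)%N by lia.
rewrite !exprD; move: (x ^+ (n - 2)) (expf_neq0 (n - 2) x0) => u u0.
by field; rewrite u0 x0.
Qed.

Lemma lift_phat n : (2 < n)%N ->
  lift_poly (n - odd n) (phat n) = quadri_core n * quadri_core_rev n.
Proof.
move=> n_gt2; have := lift_ppoly n_gt2; rewrite quadriE // quadri_revE //.
rewrite /quadri_cyc; have [n_odd|n_even] := boolP (odd n); last first.
  by rewrite /phat /= (negPf n_even) subn0 !mul1r.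
have [sh _] := phat_nat_monic n_gt2.
have X2 : 'X + 2%:R%:P = 'X - (- 2%:R)%:P :> {poly rat} by rewrite polyCN opprK.
have n1 : (1 + (n - 1) = n)%N by lia.
rewrite (phatP (n := n)) // -{1}n1 lift_polyM ?X2 ?size_XsubC // -?X2; last first.
  by rewrite sh n_odd.
(* Indeed t^2 (t^2 + t^-2 + 2) = (t^2 + 1)^2: the factor y + 2 accounts for one t^2 + 1 in each of Q
   and Q'. *)
have -> : lift_poly 1 ('X + 2%:R%:P) = sqr_add1 ^+ 2.
  apply: poly_eq_horner_neq0 => x x0; rewrite horner_lift_poly ?X2 ?size_XsubC //.
  rewrite -X2 horner_exp !hornerD !hornerX !hornerC hornerXn.
  by field.
rewrite mulrACA -expr2; apply: mulfI.
by rewrite expf_neq0 // -size_poly_eq0 size_sqr_add1.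
Qed.

(** The irreducible core divides the lift of one of two factors g and h, and that factor then has
    the full degree n - odd n. *)
Lemma phat_nat_irreducible n : (2 < n)%N -> irreducible_poly (phat n).
Proof.
move=> n_gt2; have [sh mh] := phat_nat_monic n_gt2.
split; first by rewrite sh; lia.
move=> g sg gp; have hE : phat n = g * (phat n %/ g) by rewrite mulrC divpK.
move: (phat n %/ g) hE => h hE.
have h0 : phat n != 0 by rewrite monic_neq0.
have g0 : g != 0 by apply: contraNneq h0 => g0; rewrite hE g0 mul0r.
have hh0 : h != 0 by apply: contraNneq h0 => g1; rewrite hE g1 mulr0.
have sgE : (size g).-1.+1 = size g by rewrite prednK // size_poly_gt0.
have shE : (size h).-1.+1 = size h by rewrite prednK // size_poly_gt0.
have dd : ((size g).-1 + (size h).-1 = n - odd n)%N.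
  by move: sh; rewrite hE size_mul // -sgE -shE addSn addnS => -[].
have LE := lift_phat n_gt2; rewrite hE -dd lift_polyM ?sgE ?shE // in LE.
have L0 : lift_poly (size g).-1 g * lift_poly (size h).-1 h != 0.
  by rewrite LE mulf_neq0 ?quadri_core_neq0 ?quadri_core_rev_neq0.
move: L0; rewrite mulf_eq0 negb_or => /andP[Lg0 Lh0].
have [Cg|Cg] := boolP (quadri_core n %| lift_poly (size g).-1 g).
  have le := quadri_core_dvd_lift n_gt2 (leqSpred _) Lg0 Cg.
  by rewrite -dvdp_size_eqp // sh -sgE eqSS eqn_leq le andbT -dd leq_addr.
have cop : coprimep (quadri_core n) (lift_poly (size g).-1 g).
  have [_ irr] := quadri_core_irreducible n_gt2.
  rewrite /coprimep; apply: contraNT Cg => gn1.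
  by rewrite -(eqp_dvdl _ (irr _ gn1 (dvdp_gcdl _ _))) dvdp_gcdr.
have Ch : quadri_core n %| lift_poly (size h).-1 h.
  by rewrite -(Gauss_dvdpr _ cop) LE dvdp_mulr.
have le := quadri_core_dvd_lift n_gt2 (leqSpred _) Lh0 Ch.
by case/negP: sg; rewrite -sgE eqSS -leqn0; move: le; rewrite -dd -{2}[(size h).-1]add0n leq_add2r.
Qed.

(** * Discrete representations of commuting elements *)

Section GroupMorphism.
Variables (G H : groupType) (f : {multiplicative G -> H}).

Lemma multiplicative1 : f 1%g = 1%g.
Proof. by apply: (@mulgI _ (f 1%g)); rewrite -gmulfM !mulg1. Qed.

Lemma multiplicativeV x : f x^-1%g = (f x)^-1%g.
Proof. by apply: (@mulgI _ (f x)); rewrite -gmulfM !mulgV multiplicative1. Qed.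

End GroupMorphism.

(** The identity belongs to the image and is isolated there; e is the radius of an entrywise ball
    around it. *)
Lemma discrete_rep_ball (K : numFieldType) (G : groupType)
    (rho : {multiplicative G -> SL2 K}) : discrete_rep rho ->
  exists2 e : K, 0 < e & forall g : G,
    (forall i j, `|(1%:M : 'M[K]_2) i j - (rho g : 'M[K]_2) i j| < e) -> rho g = 1%g.
Proof.
move=> /(_ 1%:M) [|_ [V /nbhs_ballP[e /= e0 eV] VA]].
  by exists 1%g => //; rewrite multiplicative1.
exists e => // g ge.
have : (V `&` range (fun g => rho g : 'M[K]_2))%classic (rho g : 'M[K]_2).
  by split; [apply: eV; split=> // i j; exact: ge | exists g].
by rewrite VA /= => gE; apply: val_inj.
Qed.

Lemma det_mx2 (K : comNzRingType) (A : 'M[K]_2) :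
  \det A = A 0 0 * A 1 1 - A 0 1 * A 1 0.
Proof.
rewrite (expand_det_row _ 0) !big_ord_recl big_ord0 /= /cofactor !det_mx11 !mxE /=.
rewrite (_ : lift _ _ = 1 :> 'I_2); last exact: val_inj.
rewrite (_ : lift _ _ = 0 :> 'I_2); last exact: val_inj.
by rewrite !expr0 ?expr1 mul1r mulN1r addr0 mulrN.
Qed.

Lemma trunc_div_close (R : realType) (d y z : R) : 0 < d -> 0 <= y -> 0 <= z ->
  Num.trunc (y / d) = Num.trunc (z / d) -> `|y - z| < d.
Proof.
move=> d0 y0 z0 yz.
have yd : 0 <= y / d by rewrite divr_ge0 // ltW.
have zd : 0 <= z / d by rewrite divr_ge0 // ltW.
have /andP[y1 y2] := truncn_itv yd; have /andP[z1 z2] := truncn_itv zd.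
move: y1 y2 z1 z2; rewrite -yz -!natr1; move: (_%:R) => t.
rewrite !ler_pdivlMr // !ltr_pdivrMr // !mulrDl mul1r => *.
by rewrite ltr_norml; apply/andP; split; lra.
Qed.

(** Pigeonhole: the square of side 2M around 0 is cut into finitely many cells of side e/2, and
    [col] numbers the cells along one axis. *)
Lemma bounded_seq_close (R : realType) (w : nat -> R[i]) (M e : R) :
  (forall i, `|w i| <= M%:C%C) -> 0 < e ->
  exists i j, i != j /\ `|w i - w j| < e%:C%C.
Proof.
move=> wM e0; pose d := e / 2; have d0 : 0 < d by rewrite divr_gt0.
pose L := Num.trunc ((2 * M) / d).
pose col (y : R) : 'I_L.+1 := inord (Num.trunc ((y + M) / d)).
have bnd (y : R) : `|y| <= M -> 0 <= y + M /\ (Num.trunc ((y + M) / d) < L.+1)%N.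
  rewrite ler_norml => /andP[y1 y2]; split; first lra.
  by rewrite ltnS; apply: le_truncn; rewrite ler_pM2r ?invr_gt0 //; lra.
have colP (y z : R) : `|y| <= M -> `|z| <= M -> col y = col z -> `|y - z| < d.
  move=> /bnd[y0 yL] /bnd[z0 zL] /(congr1 val); rewrite /= !inordK // => yz.
  by have := trunc_div_close d0 y0 z0 yz; rewrite opprD addrACA subrr addr0.
have ni : `|'i%C : R[i]| = 1 by rewrite normc_def /= expr0n expr1n add0r sqrtr1.
have ReM i : `|complex.Re (w i)| <= M.
  by rewrite -lecR (le_trans (normc_ge_Re _)).
have ImM i : `|complex.Im (w i)| <= M.
  rewrite -lecR; apply: le_trans (wM i).
  by have := normc_ge_Re (w i * 'i%C); rewrite ReiNIm normrN normrM ni mulr1.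
pose f (i : 'I_(#|{: 'I_L.+1 * 'I_L.+1}|).+1) := (col (complex.Re (w i)), col (complex.Im (w i))).
have /injectivePn[i [j ij [fr fi]]] : ~~ injectiveb f.
  apply/negP => /injectiveP /leq_card; by rewrite card_ord ltnn.
exists (nat_of_ord i), (nat_of_ord j); split => //.
have nr (r : R) : `|r%:C%C| = `|r|%:C%C by rewrite normc_def /= expr0n addr0 sqrtr_sqr.
rewrite (complexE (w i - w j)).
have -> : complex.Re (w i - w j) = complex.Re (w i) - complex.Re (w j).
  by case: (w i) (w j) => ? ? [].
have -> : complex.Im (w i - w j) = complex.Im (w i) - complex.Im (w j).
  by case: (w i) (w j) => ? ? [].
apply: le_lt_trans (ler_normD _ _) _; rewrite normrM ni mul1r !nr -rmorphD /= ltcR.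
rewrite [e]splitr; apply: ltrD; exact: colP.
Qed.

(** * Identities and diagonalisation for two-by-two matrices *)

Lemma big_ord2 (V : nmodType) (F : 'I_2 -> V) : \sum_(i < 2) F i = F 0 + F 1.
Proof. by rewrite big_ord_recl big_ord1; congr (_ + F _); apply: val_inj. Qed.

Lemma eq_mx2 (K : Type) (A B : 'M[K]_2) :
  A 0 0 = B 0 0 -> A 0 1 = B 0 1 -> A 1 0 = B 1 0 -> A 1 1 = B 1 1 -> A = B.
Proof.
have ord2 (i : 'I_2) : i = 0 \/ i = 1.
  by case: i => [[|[|//]] h]; [left|right]; apply: val_inj.
by move=> *; apply/matrixP => i j; case: (ord2 i) => ->; case: (ord2 j) => ->.
Qed.

Lemma mxtrace2 (K : nmodType) (A : 'M[K]_2) : \tr A = A 0 0 + A 1 1.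
Proof. exact: big_ord2. Qed.

Section Matrix2.
Variable K : comNzRingType.
Implicit Types A B P : 'M[K]_2.

(** With adj A = tr A - A, this is P A P = P (tr (A P) - adj (A P)) combined with adj (A P) = adj P
    adj A. It makes words such as a b a linear in the letters. *)
Lemma mx2_sandwich A P :
  P *m A *m P = \tr (A *m P) *: P - \det P *: ((\tr A)%:M - A).
Proof.
by apply: eq_mx2; rewrite !(mxE, big_ord2, mxtrace2, det_mx2) /= ?(mxE, big_ord2); ring.
Qed.

Lemma mx2_CH A : A *m A = \tr A *: A - (\det A)%:M.
Proof. by apply: eq_mx2; rewrite !(mxE, big_ord2, mxtrace2, det_mx2) /=; ring. Qed.

(** Polarisation of the Cayley-Hamilton identity. *)
Lemma mx2_polar A B : A *m B + B *m A =
  \tr A *: B + \tr B *: A + (\tr (A *m B) - \tr A * \tr B)%:M.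
Proof. by apply: eq_mx2; rewrite !(mxE, big_ord2, mxtrace2, det_mx2) /=; ring. Qed.

Lemma mx2_detD A B : \det (A + B) = \det A + \det B + \tr A * \tr B - \tr (A *m B).
Proof. by rewrite !(mxE, big_ord2, mxtrace2, det_mx2) /=; ring. Qed.

End Matrix2.

(** Bernoulli's inequality bounds the exponents j with r^j <= X, so there is a largest one. *)
Lemma exists_exp_between (R : realType) (r X : R) : 1 < r -> 1 <= X ->
  exists j : nat, r ^+ j <= X < r ^+ j.+1.
Proof.
move=> r1 X1; have bern j : 1 + j%:R * (r - 1) <= r ^+ j.
  elim: j => [|j IH]; first by rewrite mul0r addr0 expr0.
  rewrite exprS; apply: le_trans (_ : r * (1 + j%:R * (r - 1)) <= _); last first.
    by rewrite ler_pM2l // (lt_trans ltr01).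
  have : 0 <= j%:R * (r - 1) * (r - 1) by rewrite -mulrA mulr_ge0 // -expr2 sqr_ge0.
  by rewrite -natr1; move: (j%:R) => t; nra.
pose N := Num.trunc (X / (r - 1)).
have bnd j : r ^+ j <= X -> (j <= N)%N.
  move=> jX; have rd : 0 <= X / (r - 1).
    by rewrite divr_ge0 // ?subr_ge0 ?ltW // (lt_le_trans ltr01).
  rewrite /N truncn_ge_nat // ler_pdivlMr ?subr_gt0 //.
  by apply: le_trans (le_trans (bern j) jX); rewrite lerDr.
have ex : exists j, r ^+ j <= X by exists 0%N; rewrite expr0.
have [j jX jmax] := ex_maxnP ex bnd.
exists j; rewrite jX ltNge; apply/negP => /jmax; by rewrite ltnn.
Qed.

Section Idempotent.
Variables (K : fieldType) (P : 'M[K]_2).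
Hypotheses (PP : P *m P = P) (trP : \tr P = 1).

(* w P + w^-1 (1 - P) *)
Definition mx_eigen (w : K) : 'M[K]_2 := (w^-1)%:M + (w - w^-1) *: P.

Lemma mx_eigenM w w' : mx_eigen w *m mx_eigen w' = mx_eigen (w * w').
Proof.
rewrite /mx_eigen mulmxDl !mulmxDr !mul_scalar_mx !mul_mx_scalar -!scalemxAl -!scalemxAr PP.
rewrite scale_scalar_mx !scalerA invfM -!addrA -!scalerDl; congr (_ + _ *: _).
by ring.
Qed.

Lemma mx_eigen1 : mx_eigen 1 = 1%:M.
Proof. by rewrite /mx_eigen invr1 subrr scale0r addr0. Qed.

Lemma idem_det0 : \det P = 0.
Proof.
have := mx2_CH P; rewrite PP trP scale1r => /(congr1 (fun M : 'M[K]_2 => M 0 0)).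
rewrite !mxE /= mulr1n => /eqP; rewrite -subr_eq0 opprB addrCA subrr addr0.
by move=> /eqP.
Qed.

Lemma idem_comm_scale A : A *m P = P *m A -> A *m P = \tr (A *m P) *: P.
Proof.
by move=> AP; rewrite -{1}PP mulmxA {1}AP mx2_sandwich idem_det0 scale0r subr0.
Qed.

End Idempotent.

(** A acts by scalars w and w' on the images of the complementary projections P and 1 - P, and the
    determinant gives w w' = 1. *)
Lemma idem_comm_eigen (K : fieldType) (P A : 'M[K]_2) :
  P *m P = P -> \tr P = 1 -> A *m P = P *m A -> \det A = 1 ->
  exists2 w, w != 0 & A = mx_eigen P w.
Proof.
move=> PP trP AP dA; pose P' := 1%:M - P.
have PP' : P' *m P' = P'.
  by rewrite /P' mulmxBl !mulmxBr !mul1mx !mulmx1 PP subrr subr0.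
have trP' : \tr P' = 1 by rewrite /P' raddfB /= mxtrace1 trP; ring.
have AP' : A *m P' = P' *m A by rewrite /P' mulmxBl mulmxBr mul1mx mulmx1 AP.
have E := idem_comm_scale PP trP AP; have E' := idem_comm_scale PP' trP' AP'.
set w := \tr (A *m P) in E; set w' := \tr (A *m P') in E'.
have AE : A = w *: P + w' *: P'.
  by rewrite -E -E' -mulmxDr /P' addrC subrK mulmx1.
have ww' : w * w' = 1.
  rewrite -dA AE mx2_detD !detZ (idem_det0 PP trP) (idem_det0 PP' trP') !mulr0 !add0r.
  rewrite !mxtraceZ trP trP' !mulr1 -scalemxAl -scalemxAr !mxtraceZ.
  by rewrite /P' mulmxBr mulmx1 PP subrr raddf0 !mulr0 subr0.
have w0 : w != 0 by apply: contra_eq_neq ww' => ->; rewrite mul0r eq_sym oner_neq0.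
exists w => //; rewrite AE /mx_eigen (_ : w' = w^-1); last first.
  by apply: (mulfI w0); rewrite ww' mulfV.
by rewrite /P' scalerBr scalemx1 scalerBl addrCA.
Qed.

Lemma mx_eigenC (K : fieldType) (P : 'M[K]_2) w : mx_eigen (1%:M - P) w = mx_eigen P w^-1.
Proof.
rewrite /mx_eigen invrK scalerBr scalemx1 addrA -raddfD /= [w^-1 + _]addrC subrK.
by rewrite -scaleNr opprB.
Qed.

(** As the trace is neither 2 nor -2, the eigenvalues m and m + d are distinct, and (B - m) / d is
    the projection onto the eigenline of m + d. Replacing P by 1 - P inverts w, so 1 <= |w| can be
    arranged. *)
Lemma SL2_diagonalize (R : realType) (B : 'M[R[i]]_2) : \det B = 1 -> \tr B ^+ 2 != 4 ->
  exists P w, [/\ P *m P = P, \tr P = 1, B *m P = P *m B, 1 <= `|w| & B = mx_eigen P w].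
Proof.
move=> dB trB.
pose d := sqrtC (\tr B ^+ 2 - 4); have dd : d ^+ 2 = \tr B ^+ 2 - 4 by rewrite sqrtCK.
have d0 : d != 0 by rewrite -sqrf_eq0 dd subr_eq0.
pose m := (\tr B - d) / 2.
pose P := d^-1 *: (B - m%:M).
have trE : \tr B = m + m + d by rewrite /m; field.
have m1 : m * m + d * m = 1.
  have -> : m * m + d * m = (\tr B ^+ 2 - d ^+ 2) / 4 by rewrite /m; field.
  by rewrite dd; field.
have PP : P *m P = P.
  rewrite /P -scalemxAl -scalemxAr mulmxBl !mulmxBr mx2_CH dB -m1 trE.
  rewrite mul_scalar_mx mul_mx_scalar mul_scalar_mx; congr (_ *: _).
  apply: (scalerI d0); rewrite scalerA mulfV // scale1r.
  apply/matrixP => i j; rewrite !mxE; case: (i == j); rewrite ?mulr1n ?mulr0n; ring.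
have trP : \tr P = 1.
  by rewrite mxtraceZ raddfB /= mxtrace_scalar trE [_ + d]addrC addrK mulVf.
have BP : B *m P = P *m B.
  by rewrite /P -scalemxAl -scalemxAr mulmxBl mulmxBr mul_scalar_mx mul_mx_scalar.
have [w w0 BE] := idem_comm_eigen PP trP BP dB.
have [w1|w1] := real_leP (ger0_real ler01) (ger0_real (normr_ge0 w)).
  by exists P, w.
exists (1%:M - P), w^-1; split.
- by rewrite mulmxBl !mulmxBr !mul1mx !mulmx1 PP subrr subr0.
- by rewrite raddfB /= mxtrace1 trP; ring.
- by rewrite mulmxBl mulmxBr mul1mx mulmx1 BP.
- by rewrite normfV invf_ge1 ?normr_gt0 // ltW.
- by rewrite mx_eigenC invrK.
Qed.

(** * Discreteness against bounded eigenvalues *)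

Section DiscreteEigen.
Variables (R : realType) (G : groupType) (rho : {multiplicative G -> SL2 R[i]}).
Variable P : 'M[R[i]]_2.
Hypotheses (PP : P *m P = P).

Definition has_eigen (g : G) (w : R[i]) := (rho g : 'M[R[i]]_2) = mx_eigen P w.

Lemma has_eigenM g h w v : has_eigen g w -> has_eigen h v -> has_eigen (g * h)%g (w * v).
Proof.
by move=> gw hv; rewrite /has_eigen gmulfM /= [LHS](congr2 mulmx gw hv) mx_eigenM.
Qed.

Lemma has_eigen1 : has_eigen 1%g 1.
Proof. by rewrite /has_eigen multiplicative1 mx_eigen1. Qed.

Lemma has_eigenV g w : w != 0 -> has_eigen g w -> has_eigen g^-1%g w^-1.
Proof.
move=> w0 gw; rewrite /has_eigen -[LHS]mulmx1 -[1%:M](mx_eigen1 P) -(mulfV w0).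
rewrite -(mx_eigenM PP) mulmxA -[mx_eigen P w]gw.
have -> : (rho g^-1%g : 'M[R[i]]_2) *m rho g = 1%:M.
  by rewrite -[LHS]/((rho g^-1%g * rho g)%g : 'M[R[i]]_2) -gmulfM mulVg multiplicative1.
by rewrite mul1mx.
Qed.

Lemma has_eigenX g w k : has_eigen g w -> has_eigen (g ^+ k)%g (w ^+ k).
Proof.
move=> gw; elim: k => [|k IH]; first by rewrite expg0 expr0; exact: has_eigen1.
by rewrite expgS exprS; exact: has_eigenM.
Qed.

(* Two of the w i are close to each other, and then g i / g j is close to 1. *)
Lemma discrete_eigen_unbounded (g : nat -> G) (w : nat -> R[i]) (M : R) :
  discrete_rep rho -> faithful_rep rho -> injective g ->
  (forall i, has_eigen (g i) (w i)) -> (forall i, 1 <= `|w i| <= M%:C%C) -> False.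
Proof.
move=> /discrete_rep_ball[e e0 eP] rho_inj g_inj gw wM.
pose S := 1 + \sum_i \sum_j (`|P i j| + `|(1%:M - P) i j|).
have Sij i j : `|P i j| + `|(1%:M - P) i j| <= S.
  rewrite /S (bigD1 i) //= (bigD1 j) //= ler_wpDl // ler_wpDr //.
    by rewrite sumr_ge0 // => k _; rewrite sumr_ge0 // => l _; rewrite addr_ge0.
  by rewrite ler_wpDr // sumr_ge0 // => l _; rewrite addr_ge0.
have S0 : 0 < S.
  by rewrite ltr_pwDl // sumr_ge0 // => k _; rewrite sumr_ge0 // => l _.
have d0 : 0 < e / S by rewrite divr_gt0.
have dE : (complex.Re (e / S))%:C%C = e / S.
  by apply: RRe_real; apply: gtr0_real.
have [|i [j [ij wij]]] := @bounded_seq_close R w M (complex.Re (e / S)) (fun i => proj2 (andP (wM i))).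
  by rewrite -ltcR dE.
rewrite dE in wij.
have w1 k : 1 <= `|w k| by case/andP: (wM k).
have w0 k : w k != 0 by rewrite -normr_gt0 (lt_le_trans ltr01).
suff : g i = g j by move/g_inj/eqP; rewrite (negPf ij).
apply/divg1_eq; apply: rho_inj; rewrite multiplicative1; apply: eP => k l.
have -> : (rho (g i / g j)%g : 'M[R[i]]_2) = mx_eigen P (w i / w j).
  by apply: has_eigenM => //; apply: has_eigenV.
(* The two coefficients are 1 - w i / w j and 1 - w j / w i; both have modulus at most |w i - w j|,
   since 1 <= |w k| for all k. *)
have E : (1%:M : 'M[R[i]]_2) k l - mx_eigen P (w i / w j) k l =
    (w j - w i) / w j * P k l + (w i - w j) / w i * (1%:M - P) k l.
  rewrite !mxE; case: (k == l); rewrite ?mulr1n ?mulr0n invfM invrK;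
  move: (w0 i) (w0 j); move: (w i) (w j) (P k l) => x y p x0 y0; field; rewrite x0 y0 //.
rewrite E; apply: le_lt_trans (_ : `|w i - w j| * S < _).
  apply: le_trans (ler_normD _ _) _; rewrite !normrM !normfV.
  apply: le_trans (ler_wpM2l (normr_ge0 _) (Sij k l)); rewrite mulrDr.
  apply: lerD; apply: ler_wpM2r => //; rewrite ?[`|w j - w i|]distrC;
    by rewrite ler_pdivrMr ?normr_gt0 // ler_peMr.
by rewrite -ltr_pdivlMr.
Qed.

End DiscreteEigen.

(* Otherwise u and v are simultaneously diagonal, and suitable products
   u^i v^-j have their eigenvalue in a fixed annulus. *)
Lemma discrete_commuting_trace (R : realType) (G : groupType)
    (rho : {multiplicative G -> SL2 R[i]}) (u v : G) :
  discrete_rep rho -> faithful_rep rho -> commute u v ->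
  (forall i i' j j', u ^+ i * v ^+ j = u ^+ i' * v ^+ j' -> i = i' /\ j = j')%g ->
  \tr (rho v : 'M[R[i]]_2) ^+ 2 = 4.
Proof.
move=> discr faith uv indep; apply/eqP; apply: contraT => trv.
have det1 g : \det (rho g : 'M[R[i]]_2) = 1 := eqP (SL2_valP (rho g)).
have [P [m [PP trP vP m1 vm]]] := SL2_diagonalize (det1 v) trv.
have m0 : m != 0 by rewrite -normr_gt0 (lt_le_trans ltr01).
have uvM : (rho u : 'M[R[i]]_2) *m (rho v : 'M[R[i]]_2) = (rho v : 'M[R[i]]_2) *m (rho u : 'M[R[i]]_2).
  by rewrite -[LHS]/((rho u * rho v)%g : 'M[R[i]]_2) -[RHS]/((rho v * rho u)%g : 'M[R[i]]_2) -!gmulfM uv.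
have uP : (rho u : 'M[R[i]]_2) *m P = P *m (rho u : 'M[R[i]]_2).
  (* If m = 1/m, then rho v is the scalar m and its squared trace is 4 m^2 = 4. *)
  have mm : m - m^-1 != 0.
    apply: contraNneq trv => /eqP; rewrite subr_eq0 => /eqP mE.
    rewrite vm /mx_eigen -mE subrr scale0r addr0 mxtrace_scalar -[m *+ 2]mulr_natr exprMn.
    by rewrite expr2 {2}mE mulfV // mul1r; apply/eqP; ring.
  move: uvM; rewrite vm /mx_eigen mulmxDl mulmxDr mul_scalar_mx mul_mx_scalar.
  by rewrite -scalemxAl -scalemxAr => /addrI /(scalerI mm).
have [w w0 uw] := idem_comm_eigen PP trP uP (det1 u).
have realn (z : R[i]) : `|z| = (complex.Re `|z|)%:C%C by rewrite RRe_real // ger0_real.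
have inv1 (z : R[i]) : z != 0 -> `|z| < 1 -> 1 <= `|z^-1|.
  by move=> z0 z1; rewrite normfV invf_ge1 ?normr_gt0 // ltW.
(* If |w| < 1, u is replaced by its inverse. The independence hypothesis concerns nonnegative
   exponents, so it is restated for the products u'^i v^-j. *)
have [u' [w' [w'1 u'w' indep']]] : exists u' w', [/\ 1 <= `|w'|, has_eigen rho P u' w' &
  forall i i' j j', (u' ^+ i * v ^- j = u' ^+ i' * v ^- j' -> i = i')%g].
  have uX i j : (u ^+ i * v ^+ j = v ^+ j * u ^+ i)%g by apply: commuteX2.
  have [w1|w1] := real_leP (ger0_real ler01) (ger0_real (normr_ge0 w)).
    exists u, w; split => // i i' j j' E.
    suff : (u ^+ i * v ^+ j' = u ^+ i' * v ^+ j)%g by case/indep.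
    have -> : (u ^+ i = u ^+ i' * v ^- j' * v ^+ j)%g by rewrite -E mulgVK.
    by rewrite -!mulgA; congr (_ * _)%g; rewrite (commuteX2 j j' (commute_refl v)) mulKg.
  exists u^-1%g, w^-1; split; [exact: inv1|exact: has_eigenV|].
  move=> i i' j j'; rewrite !expVgn => /(congr1 (fun x : G => x^-1)%g).
  by rewrite !invgM !invgK -!uX => /indep[].
(* For |m| = 1 the powers of v alone have eigenvalues of modulus 1. *)
have [m2|m2] := eqVneq `|m| 1.
  apply: False_ind; apply: (@discrete_eigen_unbounded R G rho P PP
    (fun i => v ^+ i)%g (fun i => m ^+ i) 1) => //.
  - move=> i j vij; have [] := indep 0%N 0%N i j; by rewrite ?vij.
  - by move=> i; apply: has_eigenX.
  - by move=> i; rewrite normrX m2 expr1n !lexx.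
have m3 : 1 < complex.Re `|m| by rewrite -ltcR -realn lt_neqAle eq_sym m2.
(* Otherwise j is chosen so that |w'|^i / |m|^j lies between 1 and |m|. *)
have pow i : {j : nat | `|m| ^+ j <= `|w'| ^+ i < `|m| ^+ j.+1}.
  apply: sigW; rewrite realn [`|w'|]realn.
  have [|j] := @exists_exp_between R (complex.Re `|m|) (complex.Re `|w'| ^+ i) m3.
    by rewrite exprn_ege1 // -lecR -realn.
  by exists j; rewrite -!rmorphXn /= lecR ltcR.
pose J i := sval (pow i).
apply: False_ind; apply: (@discrete_eigen_unbounded R G rho P PP
  (fun i => u' ^+ i * v ^- (J i))%g (fun i => w' ^+ i / m ^+ (J i)) (complex.Re `|m|)) => //.
- by move=> i j /indep'.
- move=> i; apply: has_eigenM => //; first exact: has_eigenX.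
  by apply: has_eigenV; rewrite ?expf_neq0 //; apply: has_eigenX.
- move=> i; rewrite -realn normrM normfV !normrX /J; case: (pow i) => j /= /andP[j1 j2].
  have mj : 0 < `|m| ^+ j by rewrite exprn_gt0 // normr_gt0.
  by rewrite ler_pdivlMr // mul1r j1 ler_pdivrMr // -exprS ltW.
Qed.

(** * The group of the bundle *)

(** Letters acting on T compatibly with inverses and with the relations define an action of the
    presented group. *)
Lemma word_eqv_foldr (X T : Type) (rels : set (word X * word X)) (f : letter X -> T -> T) v w t :
  (forall l t, f l (f (inv_letter l) t) = t) ->
  (forall r1 r2, rels (r1, r2) -> forall t, foldr f t r1 = foldr f t r2) ->
  word_eqv rels v w -> foldr f t v = foldr f t w.
Proof.
move=> fK frel vw; elim: vw t => [//|{}v {}w _ IH t|u {}v {}w _ IH1 _ IH2 t|u {}v l t|u {}v r1 r2 rr t].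
- by rewrite IH.
- by rewrite IH1 IH2.
- by rewrite !foldr_cat /= fK.
- by rewrite !foldr_cat; congr foldr; rewrite (frel _ _ rr).
Qed.

(** The commutator b q b^-1 q^-1 of the free generators b = beta and q = alpha beta alpha^-1 of the
    fibre group; up to orientation, a conjugate of the boundary of the fibre. *)
Definition Gamma_u (n : int) : Gamma n :=
  [~ (Gamma_beta n)^-1, ((Gamma_beta n) ^ (Gamma_alpha n)^-1)^-1]%g.

Definition Gamma_v (n : int) : Gamma n := (Gamma_beta n * Gamma_alpha n)%g.

Section HeisenbergAction.
Variables (F : numFieldType) (n : int) (l c : F).
Hypotheses (l0 : l != 0) (ln : l + l^-1 = - n%:~R).
Hypothesis cn : 2 * c + l^-1 ^+ 2 = - n%:~R * c + n%:~R * (n%:~R + 1) / 2.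

(* alpha acts as the diagonal matrix (l, 1, l) and beta as a unipotent upper
   triangular matrix; cn makes the relation hold in the central entry. *)
Definition heis_act (x : letter bool) (t : F * F * F) : F * F * F :=
  let: (x1, x2, x3) := t in
  match x with
  | (false, false) => (l * x1, x2, l * x3)
  | (false, true) => (l^-1 * x1, x2, l^-1 * x3)
  | (true, false) => (x1 + x2 + c * x3, x2 + x3, x3)
  | (true, true) => (x1 - x2 + x3 - c * x3, x2 - x3, x3)
  end.

Lemma heis_actK x t : heis_act x (heis_act (inv_letter x) t) = t.
Proof.
by case: x t => [[] []] [[x1 x2] x3]; rewrite /inv_letter /= ?mulVKf ?mulKf //;
  congr (_, _, _); ring.
Qed.

Lemma heis_act_wexp (k : int) x1 x2 x3 : foldr heis_act (x1, x2, x3) (wexp true k) =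
  (x1 + k%:~R * x2 + (k%:~R * c + k%:~R * (k%:~R - 1) / 2) * x3, x2 + k%:~R * x3, x3).
Proof.
case: k => m /=.
  rewrite -[Posz m]/(m%:Z) -!pmulrn; elim: m => [|m IH].
    by rewrite /= ; congr (_, _, _); field.
  by rewrite /= IH -natr1; congr (_, _, _); field.
rewrite NegzE !mulrNz -!pmulrn; elim: m => [|m IH].
  by rewrite /= ; congr (_, _, _); field.
by move: IH; rewrite /= => ->; rewrite -[m.+2%:R]natr1; congr (_, _, _); field.
Qed.

(** For the relation, [ln] settles the matrix entries (1,2) and (2,3), and [cn] the entry (1,3). *)
Lemma heis_act_rel r1 r2 : [set Gamma_rel n]%classic (r1, r2) ->
  forall t, foldr heis_act t r1 = foldr heis_act t r2.
Proof.
move=> -[-> ->] [[x1 x2] x3]; rewrite heis_act_wexp /= mulrNz.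
congr (_, _, _).
- transitivity (x1 + (l + l^-1) * x2 + (2 * c + l^-1 ^+ 2) * x3).
    by rewrite ln cn; field.
  by field.
- transitivity (x2 + (l + l^-1) * x3); first by rewrite ln.
  by field.
- by field.
Qed.

Definition Gamma_act (g : Gamma n) t := foldr heis_act t (repr g).

Lemma Gamma_act_class w t :
  Gamma_act (presented_class [set Gamma_rel n]%classic w) t = foldr heis_act t w.
Proof. exact: word_eqv_foldr heis_actK heis_act_rel (repr_classP _ _). Qed.

Lemma Gamma_actM g h t : Gamma_act (g * h)%g t = Gamma_act g (Gamma_act h t).
Proof. by rewrite Gamma_act_class foldr_cat. Qed.

Lemma Gamma_act1 t : Gamma_act 1%g t = t.
Proof. exact: Gamma_act_class. Qed.

Lemma Gamma_actV g t t' : Gamma_act g t = t' -> Gamma_act g^-1%g t' = t.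
Proof. by move=> <-; rewrite -Gamma_actM mulVg Gamma_act1. Qed.

Lemma Gamma_act_alpha x1 x2 x3 :
  Gamma_act (Gamma_alpha n) (x1, x2, x3) = (l * x1, x2, l * x3).
Proof. exact: Gamma_act_class. Qed.

Lemma Gamma_act_beta x1 x2 x3 :
  Gamma_act (Gamma_beta n) (x1, x2, x3) = (x1 + x2 + c * x3, x2 + x3, x3).
Proof. exact: Gamma_act_class. Qed.

Lemma Gamma_act_u x1 x2 x3 :
  Gamma_act (Gamma_u n) (x1, x2, x3) = (x1 + (l^-1 - l) * x3, x2, x3).
Proof.
have aV x y z : Gamma_act (Gamma_alpha n)^-1%g (x, y, z) = (l^-1 * x, y, l^-1 * z).
  by apply: Gamma_actV; rewrite Gamma_act_alpha !mulVKf.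
have bV x y z : Gamma_act (Gamma_beta n)^-1%g (x, y, z) = (x - y + z - c * z, y - z, z).
  by apply: Gamma_actV; rewrite Gamma_act_beta; congr (_, _, _); ring.
rewrite /Gamma_u commgEl !conjgE !invgM !invgK.
rewrite !(Gamma_actM, Gamma_act_alpha, Gamma_act_beta, aV, bV).
by congr (_, _, _); field.
Qed.

Lemma Gamma_act_v x1 x2 x3 :
  Gamma_act (Gamma_v n) (x1, x2, x3) = (l * x1 + x2 + c * (l * x3), x2 + l * x3, l * x3).
Proof. by rewrite Gamma_actM Gamma_act_alpha Gamma_act_beta. Qed.

Lemma Gamma_act_uX i x1 x2 x3 :
  Gamma_act (Gamma_u n ^+ i)%g (x1, x2, x3) = (x1 + i%:R * (l^-1 - l) * x3, x2, x3).
Proof.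
elim: i => [|i IH]; first by rewrite expg0 Gamma_act1 !mul0r addr0.
by rewrite expgS Gamma_actM IH Gamma_act_u -natr1; congr (_, _, _); ring.
Qed.

Lemma Gamma_act_vX j x3 : exists t, Gamma_act (Gamma_v n ^+ j)%g (0, 0, x3) = (t, l ^+ j * x3).
Proof.
elim: j => [|j [[t1 t2] IH]]; first by exists (0, 0); rewrite expg0 Gamma_act1 expr0 mul1r.
rewrite expgS Gamma_actM IH Gamma_act_v exprS -mulrA.
by exists (l * t1 + t2 + c * (l * (l ^+ j * x3)), t2 + l * (l ^+ j * x3)).
Qed.

Hypothesis lX : forall k, l ^+ k = 1 -> k = 0%N.

Lemma heis_param_expI j j' : l ^+ j = l ^+ j' -> j = j'.
Proof.
wlog : j j' / (j <= j')%N => [H E|jj' E].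
  by have [/H->|/ltnW/H->] := leqP j j'.
have /lX/eqP : l ^+ (j' - j) = 1 by rewrite exprB ?unitfE // E mulfV // expf_neq0.
by rewrite subn_eq0 => j'j; apply/eqP; rewrite eqn_leq jj'.
Qed.

(** The third coordinate of the image of (0, 0, 1) is l^j, which determines j. Then u^i adds i (l^-1
    - l) l^j to the first coordinate, which determines i. *)
Lemma Gamma_uv_indep i i' j j' :
  (Gamma_u n ^+ i * Gamma_v n ^+ j = Gamma_u n ^+ i' * Gamma_v n ^+ j')%g ->
  i = i' /\ j = j'.
Proof.
move=> /(congr1 (fun g => Gamma_act g (0, 0, 1))); rewrite !Gamma_actM.
have [[t1 t2] jE] := Gamma_act_vX j 1; have [[t1' t2'] jE'] := Gamma_act_vX j' 1.
rewrite jE jE' !Gamma_act_uX !mulr1 => -[E1 _ E3].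
have jj := heis_param_expI E3; split=> //.
move: E1; move: jE'; rewrite -jj jE => -[<- _] /addrI /(mulIf (expf_neq0 j l0)).
have dl : l^-1 - l != 0.
  rewrite subr_eq0; apply/eqP => lV; suff /lX : l ^+ 2 = 1 by [].
  by rewrite expr2 -{1}lV mulVf.
by move=> /(mulIf dl) /eqP; rewrite eqr_nat => /eqP.
Qed.

(** The image of (0, 0, 1) under beta^k has second coordinate k, so beta has infinite order. *)
Lemma Gamma_wexp_inj k k' :
  presented_class [set Gamma_rel n]%classic (wexp true k) =
  presented_class [set Gamma_rel n]%classic (wexp true k') -> k = k'.
Proof.
move=> /(congr1 (fun g => Gamma_act g (0, 0, 1))).
rewrite !Gamma_act_class !heis_act_wexp !mulr1 !add0r => -[_ /eqP].
by rewrite eqr_int => /eqP.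
Qed.

Lemma Gamma_noncommute : ~ commute (Gamma_alpha n) (Gamma_beta n).
Proof.
move=> /(congr1 (fun g => Gamma_act g (0, 0, 1))).
rewrite !Gamma_actM !(Gamma_act_alpha, Gamma_act_beta) !(mulr0, mulr1, add0r) => -[_ l1].
by have /lX : l ^+ 1 = 1 by rewrite expr1 -l1.
Qed.

End HeisenbergAction.

(** l is a root of l^2 + n l + 1, real and different from 1 and -1 because |n| > 2, hence not a root
    of unity. The condition on c is linear, with leading coefficient n + 2 != 0. *)
Lemma heis_params (R : rcfType) (n : int) : 2 < `|n| -> exists l c : R,
  [/\ l != 0, l + l^-1 = - n%:~R,
  2 * c + l^-1 ^+ 2 = - n%:~R * c + n%:~R * (n%:~R + 1) / 2 &
  forall k, l ^+ k = 1 -> k = 0%N].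
Proof.
move=> n2; pose N : R := n%:~R.
have N4 : 0 < N ^+ 2 - 4.
  rewrite /N (_ : 4 = 4%:~R) // -rmorphXn -rmorphB ltr0z subr_gt0.
  by move: n2; rewrite expr2; nia.
pose s := Num.sqrt (N ^+ 2 - 4); have ss : s ^+ 2 = N ^+ 2 - 4 by rewrite sqr_sqrtr // ltW.
pose l := (s - N) / 2.
have ll : l * l + N * l + 1 = 0.
  have -> : l * l + N * l + 1 = (s ^+ 2 - (N ^+ 2 - 4)) / 4 by rewrite /l; field.
  by rewrite ss subrr mul0r.
have l0 : l != 0.
  by apply: contra_eq_neq ll => ->; rewrite !mulr0 !add0r oner_neq0.
have N2 : N + 2 != 0.
  by rewrite -[2]/(2%:~R) -intrD intr_eq0; apply/eqP => E; move: n2; lia.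
have ln : l + l^-1 = - N.
  apply: (mulfI l0); rewrite mulrDr mulfV //; move: ll; move: (l) (N) => u v; lra.
exists l, ((N * (N + 1) / 2 - l^-1 ^+ 2) / (N + 2)); split=> //.
  by rewrite -/N; move: (l^-1 ^+ 2) => t; field.
move=> k lk; apply/eqP; apply: contraT => k0.
have : `|l| ^+ k = 1 by rewrite -normrX lk normr1.
move/eqP; rewrite pexpr_eq1 //; last by rewrite lt0n.
rewrite -sqrp_eq1 // real_normK ?num_real // sqrf_eq1 => /orP[]/eqP lE.
  move: ll; rewrite lE => E; have : N = -2 by lra.
  by rewrite -[-2]/((-2)%:~R) => /eqP; rewrite eqr_int => /eqP nE; move: n2; rewrite nE.
move: ll; rewrite lE => E; have : N = 2 by lra.
by rewrite -[2]/(2%:~R) => /eqP; rewrite eqr_int => /eqP nE; move: n2; rewrite nE.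
Qed.

(** * The commuting pair and the relation of the group *)

Lemma commute_bundle (G : groupType) (a b d : G) :
  commute b d -> (d = b ^ a * b ^ a^-1)%g ->
  commute [~ b^-1, (b ^ a^-1)^-1]%g (b * a)%g.
Proof.
move=> bd dE; set q := (b ^ a^-1)%g; set U := commg _ _.
have qd : commute q (d ^ a^-1)%g by rewrite /commute -!conjMg bd.
have rE : (q ^ a^-1 = b^-1 * d ^ a^-1)%g.
  by rewrite dE (conjMg (b ^ a)%g) conjgK mulKg.
(* With q = a b a^-1, the relation gives a q a^-1 = b^-1 (a d a^-1), and a d a^-1 commutes with q.
   Hence a U a^-1 = b^-1 U b, which says that b a commutes with U. *)
have Ua : (U ^ a^-1 = U ^ b)%g.
  rewrite /U !conjRg !conjVg -/q rE.
  move: (d ^ a^-1)%g qd => e qe; clearbody q; clear -qe.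
  have commE x y : [~ x^-1, y^-1]%g = (x * (y * (x^-1 * y^-1)))%g :> G.
    by rewrite commgEl conjgE !invgK !mulgA.
  rewrite !commE !conjgE !invgM -!mulgA mulKg !mulVKg invgK.
  by rewrite (mulgA e) (commuteV (commute_sym qe)) -mulgA mulVKg.
by rewrite /commute mulgA (conjgC U b) -mulgA -Ua -(conjgCV a U) mulgA.
Qed.

Section GammaRelation.
Variable n : int.
Local Notation cls := (presented_class [set Gamma_rel n]%classic).

Lemma Gamma_classM v w : (cls v * cls w)%g = cls (v ++ w) :> Gamma n.
Proof. exact: presented_mul_class. Qed.

Lemma Gamma_classV v : (cls v)^-1%g = cls (inv_word v) :> Gamma n.
Proof. exact: presented_inv_class. Qed.

Definition Gamma_betaX (k : int) : Gamma n := cls (wexp true k).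

Lemma Gamma_betaXE k : Gamma_betaX k =
  match k with Posz m => (Gamma_beta n ^+ m)%g | Negz m => (Gamma_beta n ^- m.+1)%g end.
Proof.
have H m l : cls (nseq m l) = (cls [:: l] ^+ m)%g :> Gamma n.
  elim: m => [|m IH]; first by rewrite expg0.
  by rewrite expgS -IH Gamma_classM.
case: k => m; rewrite /Gamma_betaX /wexp H //.
by rewrite -expVgn Gamma_classV.
Qed.

Lemma Gamma_relation :
  Gamma_betaX (- n) = (Gamma_beta n ^ Gamma_alpha n * Gamma_beta n ^ (Gamma_alpha n)^-1)%g.
Proof.
transitivity (cls (Gamma_rel n).2 : Gamma n).
  apply/presented_classP.
  by have := @word_eqv_rel _ [set Gamma_rel n]%classic [::] [::] _ _ erefl; rewrite !cats0.
rewrite !conjgE invgK.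
rewrite /Gamma_alpha /Gamma_beta Gamma_classV.
set A := wexp false 1; set B := wexp true 1; set A' := inv_word A.
by rewrite (Gamma_classM B A) (Gamma_classM A') (Gamma_classM B A') (Gamma_classM A) Gamma_classM.
Qed.

Lemma commute_beta_betaX k : commute (Gamma_beta n) (Gamma_betaX k).
Proof.
rewrite Gamma_betaXE; case: k => m; first exact/commuteX/commute_refl.
exact/commuteV/commuteX/commute_refl.
Qed.

Lemma commute_Gamma_uv : commute (Gamma_u n) (Gamma_v n).
Proof. exact: commute_bundle (commute_beta_betaX _) Gamma_relation. Qed.

End GammaRelation.

(** * Traces *)

Lemma fpolyS k : fpoly (k + 1) = 'X * fpoly k - fpoly (k - 1).
Proof. by rewrite -fpoly_rec addrAC subrr add0r. Qed.

(** The difference f_(k+1) f_(k-1) - f_k^2 does not depend on k, and at k = 0 it is -1. *)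
Lemma fpoly_cassini k : fpoly (k + 1) * fpoly (k - 1) = fpoly k ^+ 2 - 1.
Proof.
have S (j : int) : fpoly (j + 1 + 1) * fpoly (j + 1 - 1) - fpoly (j + 1) ^+ 2 =
    fpoly (j + 1) * fpoly (j - 1) - fpoly j ^+ 2.
  rewrite [fpoly (j + 1 + 1)]fpolyS addrK fpolyS.
  by move: (fpoly j) (fpoly (j - 1)) => u v; ring.
suff H : fpoly (k + 1) * fpoly (k - 1) - fpoly k ^+ 2 = -1.
  by rewrite -H [RHS]addrC subrK.
elim/int_rect: k => [|m IH|m IH].
- by rewrite add0r sub0r fpolyN fpoly0 fpoly1 expr0n /= subr0 mul1r.
- by rewrite -addn1 PoszD S.
- by rewrite -S (_ : - m.+1%:Z + 1 = - m%:Z) //; lia.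
Qed.

Section TraceRelations.
Variables (K : numFieldType) (y : K).

Definition feval (k : int) : K := (map_poly ratr (fpoly k)).[y].

Lemma fevalS k : feval (k + 1) = y * feval k - feval (k - 1).
Proof. by rewrite /feval fpolyS rmorphB rmorphM /= map_polyX hornerD hornerN hornerM hornerX. Qed.

Lemma fevalN k : feval (- k) = - feval k.
Proof. by rewrite /feval fpolyN rmorphN hornerN. Qed.

Lemma feval_cassini k : feval (k + 1) * feval (k - 1) = feval k ^+ 2 - 1.
Proof.
rewrite /feval -hornerM -rmorphM /= fpoly_cassini rmorphB rmorphXn rmorph1 /=.
by rewrite hornerD hornerN horner_exp hornerC.
Qed.

Lemma feval_ppoly n : (map_poly ratr (ppoly n)).[y] =
  feval (n + 1) - feval (n - 1) - y ^+ 2 + 6.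
Proof.
rewrite /ppoly rmorphD !rmorphB /= map_polyXn map_polyC /= ratr_nat.
by rewrite !(hornerD, hornerN, hornerXn, hornerC).
Qed.

(** By Cayley-Hamilton this is b^k when det b = 1 and tr b = y. *)
Definition mxpow (b : 'M[K]_2) (k : int) : 'M[K]_2 := feval k *: b - (feval (k - 1))%:M.

Lemma mxpow0 b : mxpow b 0 = 1%:M.
Proof.
rewrite /mxpow sub0r fevalN /feval fpoly0 fpoly1 rmorph0 rmorph1 horner0 hornerC.
by rewrite scale0r sub0r raddfN opprK.
Qed.

Lemma mxpowS b k : \det b = 1 -> \tr b = y -> b *m mxpow b k = mxpow b (k + 1).
Proof.
move=> db tb; rewrite /mxpow mulmxBr -scalemxAr mx2_CH db tb mul_mx_scalar fevalS addrK.
by apply/matrixP => i j; rewrite !mxE; case: (i == j); rewrite ?mulr1n ?mulr0n; ring.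
Qed.

Lemma mxpowP b k : \det b = 1 -> \tr b = y -> (y%:M - b) *m mxpow b k = mxpow b (k - 1).
Proof.
move=> db tb; rewrite -{1}(subrK 1 k) -mxpowS // mulmxA mulmxBl mx2_CH db tb.
by rewrite mul_scalar_mx opprB addrC subrK mul1mx.
Qed.

Variables (a b : 'M[K]_2).
Hypotheses (da : \det a = 1) (db : \det b = 1) (tb : \tr b = y).
Hypothesis ab : a *m b != b *m a.

(** Taking the commutator with a leaves only c2 (a b - b a), and taking it with b only c1 (a b - b
    a). *)
Lemma noncommuting_free (c0 c1 c2 : K) : c1 *: a + c2 *: b + c0%:M = 0 -> [/\ c0 = 0, c1 = 0 & c2 = 0].
Proof.
move=> E; have C0 : a *m b - b *m a != 0 by rewrite subr_eq0.
have c20 : c2 = 0.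
  have : c2 *: (a *m b - b *m a) = 0.
    have := congr1 (fun M => a *m M - M *m a) E; rewrite mulmx0 mul0mx subrr => <-.
    rewrite !(mulmxDl, mulmxDr) -!scalemxAl -!scalemxAr mul_scalar_mx mul_mx_scalar.
    by apply/matrixP => i j; rewrite !mxE; ring.
  by move/eqP; rewrite scaler_eq0 (negPf C0) orbF => /eqP.
have c10 : c1 = 0.
  have : c1 *: (a *m b - b *m a) = 0.
    have := congr1 (fun M => M *m b - b *m M) E; rewrite mulmx0 mul0mx subrr => <-.
    rewrite !(mulmxDl, mulmxDr) -!scalemxAl -!scalemxAr mul_scalar_mx mul_mx_scalar.
    by apply/matrixP => i j; rewrite !mxE; ring.
  by move/eqP; rewrite scaler_eq0 (negPf C0) orbF => /eqP.
split=> //; move: E; rewrite c10 c20 !scale0r !add0r => /(congr1 (fun M : 'M[K]_2 => M 0 0)).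
by rewrite !mxE /= mulr1n.
Qed.

Variable n : int.
Hypothesis rel : a *m mxpow b (- n) *m a = b *m a *m a *m b.
Let x := \tr a.
Let z := \tr (a *m b).
Let A := feval (n + 1).
Let B := feval (n - 1).
Let f := feval n.

Lemma trace_relations : [/\ x ^+ 2 = 1 - B, x * z = y - f, f * z = (A - 1) * x & f * y = A + B].
Proof.
have fy : f * y = A + B by rewrite /A fevalS subrK mulrC.
(* These are the coefficients of 1, a and b in a b^(-n) a - b a a b. *)
suff [E0 E1 E2] : [/\ f * y - A + x ^+ 2 - 1 = 0, - f * z + A * x - x = 0 & - f - x * z + y = 0].
  split=> //.
  - by apply/eqP; rewrite -subr_eq0 -[X in _ == X]E0 fy; apply/eqP; ring.
  - by apply/eqP; rewrite -subr_eq0 -oppr_eq0 -[X in _ == X]E2; apply/eqP; ring.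
  - by apply/eqP; rewrite -subr_eq0 -oppr_eq0 -[X in _ == X]E1; apply/eqP; ring.
apply: noncommuting_free.
have E : mxpow b (- n) = - f *: b + A%:M.
  by rewrite /mxpow -opprD !fevalN raddfN opprK.
have aba : a *m b *m a = z *: a - (y%:M - b).
  by rewrite mx2_sandwich da scale1r tb mxtrace_mulC.
have bab : b *m a *m b = z *: b - (x%:M - a).
  by rewrite mx2_sandwich db scale1r.
move: rel; rewrite E mulmxDr mulmxDl -scalemxAr -scalemxAl aba mul_mx_scalar -scalemxAl.
rewrite -(mulmxA b a a) !mx2_CH da !(mulmxBr, mulmxBl) -scalemxAr -scalemxAl bab.
rewrite mulmx1 mx2_CH db tb => rel'.
apply/eqP; move: rel'; move/eqP; rewrite -subr_eq0; congr (_ == 0).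
by apply/matrixP => i j; rewrite !mxE -/x; case: (i == j); rewrite ?mulr1n ?mulr0n; ring.
Qed.

End TraceRelations.

(** For odd n the factor y + 2 has to be excluded: y = -2 would give f_n^2 = -4 with f_n
    rational. *)
Lemma phat_root (K : numFieldType) (y : K) (n : int) :
  root (map_poly ratr (ppoly n)) y ->
  feval y n ^+ 2 = feval y (n + 1) - feval y (n - 1) - 2 ->
  root (map_poly ratr (phat n)) y.
Proof.
have [n_odd|n_even] := boolP (odd `|n|%N); last by rewrite /phat (negPf n_even).
have := phatP n_odd => pE.
move=> rt; move: (rt); rewrite pE rmorphM /= rootM => /orP[|//].
rewrite rmorphD /= map_polyX map_polyC /= ratr_nat /root hornerD hornerX hornerC addr_eq0.
move=> /eqP y2 f2; move: rt; rewrite /root feval_ppoly => /eqP L0.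
pose r2 : rat := - 2%:R; have yE : y = ratr r2 by rewrite y2 /r2 rmorphN /= ratr_nat.
pose r4 : rat := - 4%:R; have : feval y n ^+ 2 = ratr r4.
  rewrite /r4 rmorphN /= ratr_nat f2 -[LHS]subr0 -L0 y2; ring.
rewrite yE /feval horner_map -rmorphXn /= => /fmorph_inj E.
by have := sqr_ge0 (fpoly n).[r2]; rewrite E.
Qed.

Lemma phat_root_trace (K : numFieldType) (a b : 'M[K]_2) (n : int) :
  let y := \tr b in
  \det a = 1 -> \det b = 1 -> a *m b != b *m a ->
  a *m mxpow y b (- n) *m a = b *m a *m a *m b -> \tr (a *m b) ^+ 2 = 4 ->
  mxpow y b (- n) != 1%:M -> mxpow y b (- n) != b *m b ->
  root (map_poly ratr (phat n)) y.
Proof.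
move=> y da db ab rel zz ne1 neb.
have [] := trace_relations da db erefl ab rel; rewrite -/y.
move: (@phat_root _ y n); rewrite /root feval_ppoly -/(root _ _).
have := feval_cassini y n.
have powE : mxpow y b (- n) = - feval y n *: b + (feval y (n + 1))%:M.
  by rewrite /mxpow -opprD !fevalN raddfN opprK.
move: powE ne1 neb zz; rewrite mx2_CH db -/y.
move: (mxpow y b (- n)) (feval y n) (feval y (n + 1)) (feval y (n - 1)) (\tr a) (\tr (a *m b)).
move=> M f A B x z ME ne1 neb zz AB pr xx xz fz fy.
(* Square f z = (A - 1) x and insert z^2 = 4, x^2 = 1 - B and f^2 = A B + 1. *)
have cubic : (A + 1) * (A * B - A + B + 3) = 0.
  have E : (A - 1) ^+ 2 * (1 - B) = 4 * (A * B + 1).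
    by rewrite -xx -exprMn -fz exprMn zz AB subrK mulrC.
  apply/eqP; rewrite -oppr_eq0 -[X in _ == X](subrr (4 * (A * B + 1))) -{1}E.
  by apply/eqP; ring.
have f2 : f ^+ 2 = A * B + 1 by rewrite AB subrK.
move/eqP: cubic; rewrite mulf_eq0 => /orP[/eqP A1|/eqP E].
  (* Here f = -y, so b^(-n) = y b - 1 = b^2, which is excluded. *)
  have AE : A = -1 by apply/eqP; rewrite -subr_eq0 opprK A1.
  have fE : f = - y.
    have f4 : f * 4 = - 2 * (y - f).
      by rewrite -zz -xz expr2 mulrA fz AE; ring.
    apply/eqP; rewrite -subr_eq0 opprK; apply/eqP.
    by apply: (mulfI (_ : 2 != 0 :> K)); rewrite ?pnatr_eq0 // mulr0;
      transitivity (f * 4 - (- 2 * (y - f))); [ring|rewrite f4 subrr].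
  by case/negP: neb; rewrite ME fE AE opprK raddfN.
have f2L : f ^+ 2 = A - B - 2.
  by rewrite f2 -[RHS]addr0 -E; ring.
(* The second factor is p_n(y). The first equals f^2; its vanishing gives f = 0 and A = 1, so b^(-n)
   = 1, which is excluded. *)
have : (A - B - 2) * (A - B - y ^+ 2 + 6) = 0.
  transitivity ((A - B) ^+ 2 - 4 - f ^+ 2 * (y ^+ 2 - 4)); first by rewrite f2L; ring.
  rewrite mulrBr -exprMn fy f2; ring.
move/eqP; rewrite mulf_eq0 => /orP[|/eqP p0]; last by apply: pr; rewrite ?p0.
rewrite -f2L sqrf_eq0 => /eqP f0; case/negP: ne1; rewrite ME f0 oppr0 scale0r add0r.
rewrite f0 mul0r in fy; rewrite f0 expr0n /= in f2L.
suff -> : A = 1 by [].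
apply: (mulfI (_ : 2 != 0 :> K)); rewrite ?pnatr_eq0 //.
transitivity ((A + B) + (A - B - 2) + 2); first ring.
by rewrite -fy -f2L; ring.
Qed.

(** * The field generated by y over the rationals *)

Lemma divring_closed_horner_rat (K : numFieldType) (k : {pred K}) (q : {poly rat}) (y : K) :
  GRing.divring_closed k -> y \in k -> (map_poly ratr q).[y] \in k.
Proof.
move=> kC; pose kP : divringClosed K := HB.pack k (GRing.isDivringClosed.Build K k kC).
rewrite -[k]/(kP : {pred K}) => yk.
rewrite horner_coef rpred_sum // => i _; rewrite rpredM ?rpredX //.
by rewrite coef_map; apply: rpred_div; apply: rpred_int.
Qed.

Section RationalAdjunction.
Variables (K : numFieldType) (y : K) (p : {poly rat}).
Hypotheses (p_irr : irreducible_poly p) (p_monic : p \is monic).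
Hypothesis py : root (map_poly ratr p) y.

Lemma root_ratr_dvdp (q : {poly rat}) : root (map_poly ratr q) y = (p %| q).
Proof.
apply/idP/idP => [qy|/dvdpP[r ->]]; last by rewrite rmorphM /= rootM py orbT.
apply: contraLR qy => npq; have cop : coprimep p q.
  rewrite /coprimep; apply: contraNT npq => gn1.
  by rewrite -(eqp_dvdl _ (p_irr.2 _ gn1 (dvdp_gcdl _ _))) dvdp_gcdr.
by rewrite /root; apply: (@coprimep_root _ (map_poly ratr p)) => //; rewrite coprimep_map.
Qed.

Lemma is_min_poly_irreducible : is_min_poly y p.
Proof. by split => // q; exact: root_ratr_dvdp. Qed.

(** The polynomials in y already form a field: if r(y) != 0, then p and r are coprime, and s p + t r
    = 1 makes t(y) the inverse of r(y). *)
Lemma gen_subfield1P (x : K) :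
  gen_subfield [set y]%classic x <-> exists q : {poly rat}, x = (map_poly ratr q).[y].
Proof.
split=> [|[q ->] k kC ky]; last by apply: divring_closed_horner_rat => //; exact: ky.
pose k : {pred K} := fun x => `[< exists q : {poly rat}, x = (map_poly ratr q).[y] >].
have kE z : z \in k <-> exists q : {poly rat}, z = (map_poly ratr q).[y].
  by rewrite unfold_in; split => /asboolP.
move=> /(_ k) H; apply/kE/H; last first.
  by move=> _ ->; apply/kE; exists 'X; rewrite map_polyX hornerX.
split; first by apply/kE; exists 1; rewrite rmorph1 hornerC.
  move=> u v /kE[q ->] /kE[r ->]; apply/kE; exists (q - r).
  by rewrite rmorphB hornerD hornerN.
move=> u v /kE[q ->] /kE[r ->]; apply/kE.
have [r0|r0] := eqVneq (map_poly ratr r).[y] 0.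
  by exists 0; rewrite r0 invr0 mulr0 rmorph0 horner0.
have cop : coprimep p r.
  rewrite /coprimep; apply: contraNT r0 => gn1.
  rewrite -/(root _ _) root_ratr_dvdp.
  by rewrite -(eqp_dvdl _ (p_irr.2 _ gn1 (dvdp_gcdl _ _))) dvdp_gcdr.
have /Bezout_eq1_coprimepP[[s t] /= E] := cop.
have /(congr1 (fun q => (map_poly ratr q).[y])) := E.
rewrite rmorphD !rmorphM rmorph1 hornerD !hornerM hornerC (eqP py) mulr0 add0r => tr1.
by exists (q * t); rewrite rmorphM hornerM -(mulr1_eq (etrans (mulrC _ _) tr1)).
Qed.

(** The powers of y below the degree of p form a basis. The coordinates of q(y) are the coefficients
    of q modulo p, unique because p divides no nonzero polynomial of smaller degree. *)
Lemma gen_subfield1_degree : has_degree (gen_subfield [set y]%classic) (size p).-1.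
Proof.
have p0 : p != 0 by rewrite monic_neq0.
have sp : (size p).-1.+1 = size p by rewrite prednK // size_poly_gt0.
pose ev (c : 'rV[rat]_(size p).-1) : {poly rat} := rVpoly c.
have evE c : (map_poly ratr (ev c)).[y] = \sum_(i < (size p).-1) ratr (c 0 i) * y ^+ i.
  rewrite (@horner_coef_wide _ (size p).-1) ?size_map_poly ?size_poly //.
  by apply: eq_bigr => i _; rewrite coef_map coef_rVpoly_ord.
exists (fun i => y ^+ i); split.
  by move=> i; apply/gen_subfield1P; exists 'X^i; rewrite map_polyXn hornerXn.
move=> x /gen_subfield1P[q ->].
exists (poly_rV (q %% p)); split.
  rewrite -evE /ev poly_rV_K; last by rewrite -ltnS sp ltn_modp.
  by rewrite {1}(divp_eq q p) rmorphD rmorphM /= hornerD hornerM (eqP py) mulr0 add0r.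
move=> c; rewrite -evE => E.
have : root (map_poly ratr (q - ev c)) y.
  by rewrite /root rmorphB hornerD hornerN E subrr.
rewrite root_ratr_dvdp => dv.
have : q %% p = ev c.
  apply/eqP; rewrite -subr_eq0.
  have dv' : p %| q %% p - ev c.
    by rewrite -(dvdp_addr _ (dvdp_mulIr (q %/ p) p)) addrA -divp_eq.
  apply: contraLR dv' => nz; apply/negP => /(dvdp_leq nz); apply/negP; rewrite -ltnNge.
  rewrite -sp ltnS; apply: leq_trans (size_polyD _ _) _; rewrite geq_max size_polyN size_poly.
  by rewrite andbT -ltnS sp ltn_modp.
by move=> ->; rewrite rVpolyK.
Qed.

End RationalAdjunction.

(** * Traces of words in two matrices *)

Section TraceSpan.
Variables (K : fieldType) (k : divringClosed K) (a b : 'M[K]_2).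
Hypotheses (da : \det a = 1) (db : \det b = 1).
Hypotheses (xk : \tr a \in k) (yk : \tr b \in k) (zk : \tr (a *m b) \in k).

(** This k-span is stable under left multiplication by a, b and their inverses, so it contains the
    image of every word. *)
Definition mxspan (M : 'M[K]_2) := exists c0 c1 c2 c3, [/\ c0 \in k, c1 \in k, c2 \in k, c3 \in k &
  M = c0%:M + c1 *: a + c2 *: b + c3 *: (a *m b)].

Lemma mxspan1 : mxspan 1%:M.
Proof.
exists 1, 0, 0, 0; split; rewrite ?rpred1 ?rpred0 //.
by rewrite !scale0r !addr0.
Qed.

(** This shape serves the inverses: g^-1 M = (tr g) M - g M when det g = 1. *)
Lemma mxspanB_scale c M M' : c \in k -> mxspan M -> mxspan M' -> mxspan (c%:M *m M - M').
Proof.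
move=> ck [c0 [c1 [c2 [c3 [k0 k1 k2 k3 ->]]]]] [d0 [d1 [d2 [d3 [l0 l1 l2 l3 ->]]]]].
exists (c * c0 - d0), (c * c1 - d1), (c * c2 - d2), (c * c3 - d3).
split; rewrite ?rpredB ?rpredM //.
rewrite mul_scalar_mx; move: (a *m b) => ab; apply/matrixP => i j; rewrite !mxE.
by case: (i == j); rewrite ?mulr1n ?mulr0n; ring.
Qed.

Lemma mxspan_mull M : mxspan M -> mxspan (a *m M).
Proof.
move=> [c0 [c1 [c2 [c3 [k0 k1 k2 k3 ->]]]]].
exists (- c1), (c0 + c1 * \tr a), (- c3), (c2 + c3 * \tr a).
split; rewrite ?rpredN ?rpredD ?rpredM //.
rewrite !mulmxDr -!scalemxAr mulmxA mx2_CH da mulmxBl mul1mx -scalemxAl mul_mx_scalar.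
move: (a *m b) (\tr a) => ab x; apply/matrixP => i j; rewrite !mxE.
by case: (i == j); rewrite ?mulr1n ?mulr0n; ring.
Qed.

Lemma mxspan_mulr M : mxspan M -> mxspan (b *m M).
Proof.
move=> [c0 [c1 [c2 [c3 [k0 k1 k2 k3 ->]]]]].
pose x := \tr a; pose y := \tr b; pose z := \tr (a *m b).
exists (c1 * (z - x * y) - c2 - c3 * x), (c1 * y + c3), (c0 + c1 * x + c2 * y + c3 * z), (- c1).
split; do ?[by []|apply: rpredB|apply: rpredD|apply: rpredM|rewrite rpredN].
rewrite !mulmxDr -!scalemxAr mulmxA mx2_CH mx2_sandwich db mul_mx_scalar.
have -> : b *m a = x *: b + y *: a + (z - x * y)%:M - a *m b.
  by rewrite -mx2_polar addrC addKr.
rewrite -/x -/y -/z.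
move: (a *m b) x y z => ab x y z; apply/matrixP => i j; rewrite !mxE.
by case: (i == j); rewrite ?mulr1n ?mulr0n; ring.
Qed.

Lemma mxspan_trace M : mxspan M -> \tr M \in k.
Proof.
move=> [c0 [c1 [c2 [c3 [k0 k1 k2 k3 ->]]]]].
rewrite !raddfD /= !mxtraceZ mxtrace_scalar.
by rewrite !rpredD ?rpredM ?rpredMn.
Qed.

End TraceSpan.

Lemma SL2_invE (K : fieldType) (g : SL2 K) :
  (g^-1%g : 'M[K]_2) = (\tr (g : 'M[K]_2))%:M - (g : 'M[K]_2).
Proof.
have gg : (g : 'M[K]_2) *m ((\tr (g : 'M[K]_2))%:M - (g : 'M[K]_2)) = 1%:M.
  by rewrite mulmxBr mul_mx_scalar mx2_CH (eqP (SL2_valP g)) opprB addrC subrK.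
have gV : (g^-1%g : 'M[K]_2) *m (g : 'M[K]_2) = 1%:M.
  by rewrite -[LHS]/((g^-1 * g)%g : 'M[K]_2) mulVg.
by rewrite -[LHS]mulmx1 -gg mulmxA gV mul1mx.
Qed.

(** * The representation and its trace field *)

Section Main.
Variables (K : numFieldType) (n : int) (rho : {multiplicative Gamma n -> SL2 K}).
Local Notation a := (rho (Gamma_alpha n) : 'M[K]_2).
Local Notation b := (rho (Gamma_beta n) : 'M[K]_2).

Lemma rhoM g h : (rho (g * h)%g : 'M[K]_2) = (rho g : 'M[K]_2) *m (rho h : 'M[K]_2).
Proof. by rewrite gmulfM. Qed.

Lemma rhoV g : (rho g^-1%g : 'M[K]_2) = (\tr (rho g : 'M[K]_2))%:M - (rho g : 'M[K]_2).
Proof. by rewrite multiplicativeV SL2_invE. Qed.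

Lemma rho_det g : \det (rho g : 'M[K]_2) = 1.
Proof. exact/eqP/(SL2_valP (rho g)). Qed.

Lemma rho_trace_closed (k : divringClosed K) g :
  \tr a \in k -> \tr b \in k -> \tr (a *m b) \in k -> \tr (rho g : 'M[K]_2) \in k.
Proof.
move=> xk yk zk; apply: (@mxspan_trace _ k a b) => //.
rewrite -(presented_reprK g); elim: (repr g) => [|l w IH].
  have -> : presented_class [set Gamma_rel n]%classic [::] = 1%g :> Gamma n by [].
  by rewrite multiplicative1; exact: mxspan1.
rewrite -cat1s -Gamma_classM rhoM.
move: IH; move: (rho (presented_class _ w) : 'M[K]_2) => M.
case: l => [[] []] MS.
- rewrite (_ : presented_class _ _ = (Gamma_beta n)^-1%g); last by rewrite Gamma_classV.
  rewrite rhoV mulmxBl; apply: mxspanB_scale => //; apply: mxspan_mulr => //; exact: rho_det.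
- by apply: mxspan_mulr => //; exact: rho_det.
- rewrite (_ : presented_class _ _ = (Gamma_alpha n)^-1%g); last by rewrite Gamma_classV.
  rewrite rhoV mulmxBl; apply: mxspanB_scale => //; apply: mxspan_mull => //; exact: rho_det.
- by apply: mxspan_mull => //; exact: rho_det.
Qed.

Lemma rho_betaX j : (rho (Gamma_betaX n j) : 'M[K]_2) = mxpow (\tr b) b j.
Proof.
rewrite Gamma_betaXE; case: j => m.
  elim: m => [|m IH]; first by rewrite expg0 multiplicative1 mxpow0.
  by rewrite expgS rhoM IH mxpowS ?rho_det // -PoszD addn1.
rewrite -expVgn; elim: m => [|m IH].
  by rewrite expg1 rhoV -[LHS]mulmx1 -(mxpow0 (\tr b) b) mxpowP ?rho_det.
by rewrite expgS rhoM IH rhoV mxpowP ?rho_det // !NegzE -opprD -PoszD addn1.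
Qed.

Lemma rho_relation : a *m mxpow (\tr b) b (- n) *m a = b *m a *m a *m b.
Proof.
rewrite -rho_betaX -!rhoM; congr (rho _ : 'M[K]_2).
by rewrite Gamma_relation !conjgE invgK !mulgA mulgV mul1g mulgVK.
Qed.

End Main.

Lemma phat_abs n : phat n = phat `|n|%N.
Proof. by case: n => // m; rewrite NegzE phatN abszN. Qed.

Theorem theorem6p7 (n : int) (hn : 2 < `|n|) :
  irreducible_poly (phat n) /\
  forall (R : realType) (rho : {multiplicative Gamma n -> SL2 R[i]}),
    discrete_rep rho -> faithful_rep rho ->
    let y0 := \tr (rho (Gamma_beta n) : 'M[R[i]]_2) in
    [/\ trace_field rho = gen_subfield (set1 y0),
        is_min_poly y0 (phat n)
      & has_degree (trace_field rho) (`|n| - odd `|n|)%N].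
Proof.
have n_gt2 : (2 < `|n|)%N by rewrite -ltz_nat abszE.
have irr : irreducible_poly (phat n) by rewrite phat_abs; exact: phat_nat_irreducible.
split=> // R rho discr faith y0.
have [l [c [l0 ln cn lX]]] := heis_params R hn.
pose a := (rho (Gamma_alpha n) : 'M[R[i]]_2); pose b := (rho (Gamma_beta n) : 'M[R[i]]_2).
have rho_inj g h : (rho g : 'M[R[i]]_2) = (rho h : 'M[R[i]]_2) -> g = h.
  by move=> gh; apply/faith/val_inj.
(* The trace of a b is that of b a, the image of [Gamma_v n], which commutes with [Gamma_u n] and is
   independent of it. *)
have zz : \tr (a *m b) ^+ 2 = 4.
  rewrite mxtrace_mulC -rhoM.
  apply: (discrete_commuting_trace discr faith (commute_Gamma_uv n)) => i i' j j'.
  exact: Gamma_uv_indep l0 ln cn lX _ _ _ _.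
have ab : a *m b != b *m a.
  apply/eqP; rewrite -!rhoM => /rho_inj; exact: Gamma_noncommute l0 ln cn lX.
have betaX_inj := Gamma_wexp_inj l0 ln cn.
(* As beta has infinite order and rho is faithful, b^(-n) is 1 or b^2 only if n is 0 or -2. *)
have ne1 : mxpow y0 b (- n) != 1%:M.
  rewrite -rho_betaX; apply/eqP => E; have /betaX_inj n0 : Gamma_betaX n (- n) = Gamma_betaX n 0.
    by apply: rho_inj; rewrite E rho_betaX mxpow0.
  by move: hn; rewrite -normrN n0.
have neb : mxpow y0 b (- n) != b *m b.
  rewrite -rho_betaX; apply/eqP => E; have /betaX_inj n0 : Gamma_betaX n (- n) = Gamma_betaX n 2.
    by apply: rho_inj; rewrite E -rhoM Gamma_betaXE /= expg2.
  by move: hn; rewrite -normrN n0.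
have root_y := phat_root_trace (rho_det rho _) (rho_det rho _) ab (rho_relation rho) zz ne1 neb.
have [sp mp] := phat_nat_monic n_gt2; rewrite -phat_abs in sp mp.
have TF : trace_field rho = gen_subfield (set1 y0).
  apply/seteqP; split => x; last first.
    by move=> xS k kC ky; apply: xS => // _ ->; apply: ky; exists (Gamma_beta n).
  move=> xS k kC ky; apply: xS => // _ [g _ <-].
  have yk : y0 \in k by exact: ky.
  pose kP : divringClosed R[i] := HB.pack k (GRing.isDivringClosed.Build _ k kC).
  (* The trace z is 2 or -2, hence lies in every subfield. *)
  have zk : \tr (a *m b) \in kP.
    move/eqP: zz; rewrite (_ : 4 = 2 ^+ 2); last by rewrite -natrX.
    by rewrite eqf_sqr => /orP[]/eqP->; rewrite ?rpredN rpred_nat.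
  have [_ xz _ _] := trace_relations (rho_det rho _) (rho_det rho _) erefl ab (rho_relation rho).
  have z0 : \tr (a *m b) != 0.
    by rewrite -sqrf_eq0 zz pnatr_eq0.
  apply: (@rho_trace_closed _ n rho kP) => //.
  (* The trace of a is recovered as x = (y - f_n) / z. *)
  rewrite -[\tr _](mulfK z0) xz; apply: rpred_div => //.
  by apply: rpredB => //; exact: divring_closed_horner_rat.
split => //; first exact: is_min_poly_irreducible.
by rewrite TF -[(`|n| - _)%N]/(_.+1.-1) -sp; exact: gen_subfield1_degree.
Qed.
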